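(* Let $p>3$ be a prime and let $\mathcal{A}$ be an S-ring over the group $G=E_9\times C_p$. Then at least one of the following statements holds: (1) $\mathcal{A}$ is trivial or cyclotomic; (2) $\mathcal{A}$ is the tensor product of a trivial S-ring and an S-ring over $C_3$; (3) $\mathcal{A}$ is a proper $S$-wreath product for some $\mathcal{A}$-section $S$ with $|S|\le 3$.
   Context: $E_9\cong C_3\times C_3$, and $C_n$ is the cyclic group of order $n$. S-ring: let $G$ be a finite group with identity $e$. For $X\subseteq G$ put $\underline{X}=\sum_{x\in X}x\in\mathbb{Z}G$. A subring $\mathcal{A}$ of the group ring $\mathbb{Z}G$ is an S-ring over $G$ if there is a partition $\mathcal{S}(\mathcal{A})$ of $G$, whose classes are called the basic sets of $\mathcal{A}$, such that $\{e\}$ is a class; $X\in\mathcal{S}(\mathcal{A})$ implies $X^{-1}\in\mathcal{S}(\mathcal{A})$; and $\mathcal{A}$ is the $\mathbb{Z}$-span of $\{\underline{X}: X\in\mathcal{S}(\mathcal{A})\}$. The rank of $\mathcal{A}$ is $|\mathcal{S}(\mathcal{A})|$. An $\mathcal{A}$-subgroup is a subgroup of $G$ that is a union of basic sets. Trivial: an S-ring over a nontrivial group $G$ is trivial if it has rank $2$, i.e., its basic sets are $\{e\}$ and $G\setminus\{e\}$. Cyclotomic: $\mathcal{A}$ is cyclotomic if there is $M\le\mathrm{Aut}(G)$ such that $\mathcal{S}(\mathcal{A})$ is the set of orbits of $M$ on $G$. Tensor product: if $G=G_1\times G_2$ and $\mathcal{A}_i$ is an S-ring over $G_i$, then $\mathcal{A}_1\otimes\mathcal{A}_2$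 is the S-ring over $G$ with basic sets $X_1\times X_2$, $X_i\in\mathcal{S}(\mathcal{A}_i)$. (In (2), $G$ is the internal direct product of a subgroup isomorphic to $C_3$ and a complement to it.) Wreath product: an $\mathcal{A}$-section is a section $S=U/L$ of $G$ with $U$ and $L$ both $\mathcal{A}$-subgroups. For $X\subseteq G$ put $\mathrm{rad}(X)=\{g\in G: gX=Xg=X\}$. The S-ring $\mathcal{A}$ is an $S$-wreath product, $S=U/L$, if $L\trianglelefteq G$ and $L\le\mathrm{rad}(X)$ for every basic set $X$ not contained in $U$. It is proper if $L\ne 1$ and $U\ne G$. *)

(* Defs.v *)
From HB Require Import structures.
From mathcomp Require Import all_boot all_order all_algebra all_fingroup all_solvable.

Set Implicit Arguments.
Unset Strict Implicit.
Unset Printing Implicit Defensive.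

Import GroupScope GRing.Theory.
Local Open Scope ring_scope.

(* The integral group ring of the full group on gT, under convolution.  For   *)
(* G : {group gT}, ZG sits inside it as the functions supported on G.  The    *)
(* alias keeps the pointwise product of {ffun gT -> int} from being inferred. *)
Definition group_ring (gT : finGroupType) : Type := {ffun gT -> int}.

HB.instance Definition _ (gT : finGroupType) :=
  GRing.Zmodule.copy (group_ring gT) {ffun gT -> int}.

Section GroupRing.
Variable gT : finGroupType.
Implicit Types (a b c : group_ring gT) (x y z : gT).

Definition gr_one : group_ring gT := [ffun x => (x == 1%g)%:R].
Definition gr_mul a b : group_ring gT :=
  [ffun x => \sum_y a y * b (y^-1 * x)%g].

Fact gr_mulA : associative gr_mul.
Proof.
move=> a b c; apply/ffunP=> x; rewrite !ffunE.
under eq_bigr => y _ do rewrite ffunE mulr_sumr.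
under [RHS]eq_bigr => z _ do rewrite ffunE mulr_suml.
rewrite [RHS]exchange_big /=; apply: eq_bigr => y _.
rewrite (reindex_inj (mulgI y^-1%g)) /=; apply: eq_bigr => z _.
by rewrite mulrA invMg invgK mulgA mulgK.
Qed.

Fact gr_mul1 : left_id gr_one gr_mul.
Proof.
move=> a; apply/ffunP=> x; rewrite !ffunE (bigD1 1%g) //= big1 => [|y yN1].
  by rewrite ffunE eqxx mul1r invg1 mul1g addr0.
by rewrite ffunE (negbTE yN1) mul0r.
Qed.

Fact gr_mulr1 : right_id gr_one gr_mul.
Proof.
move=> a; apply/ffunP=> x; rewrite !ffunE (bigD1 x) //= big1 => [|y yNx].
  by rewrite ffunE mulVg eqxx mulr1 addr0.
by rewrite ffunE -eq_mulVg1 (negbTE yNx) mulr0.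
Qed.

Fact gr_mulDl : left_distributive gr_mul +%R.
Proof.
move=> a b c; apply/ffunP=> x; rewrite !ffunE -big_split /=.
by apply: eq_bigr => y _; rewrite ffunE mulrDl.
Qed.

Fact gr_mulDr : right_distributive gr_mul +%R.
Proof.
move=> a b c; apply/ffunP=> x; rewrite !ffunE -big_split /=.
by apply: eq_bigr => y _; rewrite ffunE mulrDr.
Qed.

Fact gr_one_neq0 : gr_one != 0.
Proof. by apply/eqP => /ffunP/(_ 1%g); rewrite !ffunE eqxx. Qed.

End GroupRing.

HB.instance Definition _ (gT : finGroupType) :=
  GRing.Zmodule_isNzRing.Build (group_ring gT) (@gr_mulA gT) (@gr_mul1 gT)
    (@gr_mulr1 gT) (@gr_mulDl gT) (@gr_mulDr gT) (@gr_one_neq0 gT).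

Definition simple_quantity (gT : finGroupType) (X : {set gT}) : group_ring gT :=
  [ffun x => (x \in X)%:R].

(* The basic sets are recorded as a field, but they are determined by the     *)
(* subring.  The span condition forces the subring to lie in ZG.              *)
Record sring (gT : finGroupType) (G : {group gT}) := SRing {
  sring_pred : {pred group_ring gT};
  basic_sets : {set {set gT}};
  sring_subring : subring_closed sring_pred;
  basic_partition : partition basic_sets G;
  basic_1 : [set 1%g] \in basic_sets;
  basic_inv : forall X, X \in basic_sets -> X^-1%g \in basic_sets;
  sring_span : forall a, a \in sring_pred <->
    exists c : {set gT} -> int,
      a = \sum_(X in basic_sets) simple_quantity X *~ c X
}.

Section SRingTheory.
Variables (gT : finGroupType) (G : {group gT}).
Implicit Types (A : sring G) (X : {set gT}) (U L : {group gT}).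

Definition sring_rank A : nat := #|basic_sets A|.

(* Rank 2 already forces G to be nontrivial. *)
Definition trivial_sring A : Prop := sring_rank A = 2%N.

Definition cyclotomic A : Prop :=
  exists2 M : {group {perm gT}}, M \subset Aut G
    & basic_sets A = orbit 'P M @: G.

(* G is the internal direct product of G1 and G2, so X1 * X2 is the set of    *)
(* products, which corresponds to the cartesian product.                      *)
Definition is_tensor_product (G1 G2 : {group gT})
    A (A1 : sring G1) (A2 : sring G2) : Prop :=
  G1 \x G2 = G /\
  basic_sets A = [set (X1 * X2)%g | X1 in basic_sets A1, X2 in basic_sets A2].

Definition sring_subgroup A U : Prop :=
  U \subset G /\
  exists2 Q : {set {set gT}}, Q \subset basic_sets A & U = cover Q :> {set gT}.

Definition sring_section A U L : Prop :=
  [/\ L <| U, sring_subgroup A U & sring_subgroup A L].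

Definition sring_rad X : {set gT} :=
  [set g in G | (g *: X == X)%g && (X :* g == X)%g].

Definition is_wreath_product A U L : Prop :=
  [/\ sring_section A U L, L <| G
    & forall X, X \in basic_sets A -> ~~ (X \subset U) -> L \subset sring_rad X].

Definition is_proper_wreath_product A U L : Prop :=
  [/\ is_wreath_product A U L, L :!=: 1%g & U :!=: G].

End SRingTheory.

(* Main.v *)
(* Let G = E P with |E| = 9 and |P| = p.  Power maps x |-> x^n with n prime   *)
(* to |G| permute the basic sets, and for a union X of basic sets and a prime *)
(* q, the g in G such that q does not divide #{x in X | x^q = g} again form a  *)
(* union of basic sets (Frobenius in ZG modulo q).                             *)
(*   If E is not an A-subgroup, taking q = p shows that a basic set X meeting  *)
(* a coset hP, with h outside the largest A-subgroup E1 of E, contains hP.     *)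
(* So X is stable under the multipliers of P, and an analysis of X E1 leaves   *)
(* the trivial S-ring, a wreath product, or, for |E1| = 3, a tensor product.   *)
(*   If E is an A-subgroup but P is not, taking q = 3 shows that 3 divides the *)
(* size of each X :&: xE with x outside E.  As the multiplier -1 of E fixes    *)
(* the basic set of z in P, its slices are L z with |L| in {3, 9}, and A is    *)
(* an E/L-wreath product.                                                      *)
(*   If E and P are both A-subgroups, colour u in E by the basic set of u z,   *)
(* for z in P.  A Fourier inversion on P shows that the colours are the basic  *)
(* sets of an S-ring over E, and that moving z inside its basic set induces an *)
(* algebraic automorphism of it.  A finite check over C_3 x C_3 shows that     *)
(* algebraic isomorphisms of such S-rings are induced by Aut E, with any two   *)
(* points of corresponding colours matched; so A is cyclotomic.                *)
Require Import Defs.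
From mathcomp Require Import all_boot all_order all_algebra all_fingroup all_solvable.

Set Implicit Arguments.
Unset Strict Implicit.
Unset Printing Implicit Defensive.

Import GroupScope GRing.Theory Num.Theory.

(** * Values in the group ring *)

(** Call a union of basic sets an A-set. Write G = E P with |E| = 9 and |P| = p. Three tools are
    used throughout. Multipliers permute the basic sets and, by the Chinese remainder theorem, act
    on E and P independently ([twistP], [flipE]). The Frobenius identity for q = p and q = 3
    controls the slices of an A-set along cosets of P modulo p and along cosets of E modulo 3
    ([sring_set_root_p], [sring_set_root_3]). Finally |S ∩ xT| is constant for x in a basic set when
    S and T are A-sets ([card_lcoset_basic]), so stabilizers of A-sets are A-subgroups.

    Suppose E is not an A-subgroup, and let E1 < E be the largest A-subgroup inside it. A basic set
    meeting hP with h in E outside E1 contains hP. If E1 P is an A-subgroup, this makes A a wreath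
    product ([wreath_core_mul]). Otherwise a basic set X joins E1 P to E outside E1, and X E1 ∪ E1
    is a group ([stabilizer_mixed]). When E1 = 1, either this group is G and the rank is 2, or A is
    a wreath product with U = L. When |E1| = 3 the group is G, so all basic sets outside E1 are
    equidistributed over the cosets of E1; [core3_wreath_or_tensor] then yields a wreath product or
    an A-subgroup U of rank 2 complementing E1, along which A splits by [basic_setM].

    If E is an A-subgroup and P is not, all slices outside E have size divisible by 3; together with
    the symmetry under inversion on E this forces a wreath product ([only_E_wreath]).

    If both are A-subgroups, the basic sets met by Ez colour E. By [slice_count_basic] this
    colouring has well-defined structure constants, which do not change when z moves in its basic
    set. The finite check [colour_isos_linear] turns such coincidences into automorphisms of E, and
    these extend to automorphisms of G that preserve and are transitive on each basic set
    ([both_cyclotomic]). *)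

Section GroupRingValues.

Variable gT : finGroupType.
Implicit Types (a b : group_ring gT) (S T : {set gT}).

Lemma group_ring_mulE a b x :
  (a * b)%R x = (\sum_y a y * b (y^-1 * x)%g)%R.
Proof. by rewrite /GRing.mul /= ffunE. Qed.

Lemma group_ring_sumE (I : Type) (r : seq I) (P : pred I)
    (F : I -> group_ring gT) x :
  (\sum_(i <- r | P i) F i)%R x = (\sum_(i <- r | P i) F i x)%R.
Proof.
by apply: (big_morph (fun a : group_ring gT => a x)) => [a b|]; rewrite !ffunE.
Qed.

Lemma group_ring_mulrnE a n x : (a *+ n)%R x = (a x *+ n)%R.
Proof. by elim: n => [|n IHn]; rewrite ?mulr0n ?ffunE // !mulrS ffunE IHn. Qed.

Lemma group_ring_mulrzE a (m : int) x : (a *~ m)%R x = (a x * m)%R.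
Proof.
case: m => n; rewrite /intmul ?ffunE group_ring_mulrnE -mulr_natr natz //.
by rewrite NegzE mulrN.
Qed.

Lemma simple_quantity_mulE S T x :
  (simple_quantity S * simple_quantity T)%R x
    = (#|[set y in S | y^-1 * x \in T]%g|%:R)%R.
Proof.
rewrite group_ring_mulE (eq_bigr (fun y => ((y \in S) && (y^-1 * x \in T)%g)%:R)%R).
  rewrite -natr_sum -sum1dep_card [in RHS]big_mkcond /=.
  by congr (_%:R)%R; apply: eq_bigr => y _; case: (_ && _).
by move=> y _; rewrite !ffunE -natrM mulnb.
Qed.

Definition push_forward (f : gT -> gT) S : group_ring gT :=
  [ffun g => (#|[set x in S | f x == g]|%:R)%R].

Lemma push_forwardE f S :
  push_forward f S = (\sum_(x in S) simple_quantity [set f x])%R.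
Proof.
apply/ffunP=> g; rewrite group_ring_sumE ffunE -sum1dep_card natr_sum.
rewrite big_mkcondr; apply: eq_bigr => x _ /=.
by rewrite ffunE inE eq_sym; case: eqP.
Qed.

Lemma simple_quantityE S :
  simple_quantity S = (\sum_(x in S) simple_quantity [set x])%R.
Proof.
apply/ffunP=> g; rewrite group_ring_sumE ffunE.
rewrite (eq_bigr (fun x => if x == g then 1 else 0)%R) => [|x _]; last first.
  by rewrite ffunE inE eq_sym; case: eqP.
rewrite -big_mkcondr; case: (boolP (g \in S)) => Sg.
  by rewrite (big_pred1 g) // => x; rewrite /= andbC; case: eqP => [->|].
by rewrite big_pred0 // => x; rewrite andbC; case: eqP => [->|]; rewrite ?(negbTE Sg).
Qed.

Lemma simple_quantity1M (x y : gT) :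
  (simple_quantity [set x] * simple_quantity [set y])%R
    = simple_quantity [set x * y]%g.
Proof.
apply/ffunP=> g; rewrite simple_quantity_mulE ffunE inE.
have -> : [set z in [set x] | z^-1 * g \in [set y]]
          = if g == x * y then [set x] else set0.
  apply/setP=> z; rewrite !inE; case: (g =P x * y) => [->|ne_g]; rewrite ?inE.
    by case: (z =P x) => //= ->; rewrite mulKg eqxx.
  by apply/andP=> -[/eqP zx /eqP zg]; case: ne_g; rewrite -zx -zg mulKVg.
by case: ifP; rewrite ?cards1 ?cards0.
Qed.

Lemma simple_quantity1X (x : gT) n :
  (simple_quantity [set x] ^+ n)%R = simple_quantity [set x ^+ n]%g.
Proof.
elim: n => [|n IHn]; last by rewrite exprS IHn simple_quantity1M expgS.
by apply/ffunP=> g; rewrite !ffunE inE.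
Qed.

End GroupRingValues.

(** * The Frobenius identity modulo a prime *)

Lemma exprD_prime_comm (R : nzRingType) (q : nat) (x y : R) :
  prime q -> GRing.comm x y ->
  exists c, ((x + y) ^+ q = x ^+ q + y ^+ q + c *+ q)%R.
Proof.
case: q => // n q_pr cxy.
exists (\sum_(i < n) x ^+ (n - i) * y ^+ i.+1 *+ ('C(n.+1, i.+1) %/ n.+1))%R.
rewrite exprDn_comm // big_ord_recl big_ord_recr /= subn0 bin0 binn subnn.
rewrite !expr0 mulr1 mul1r !mulr1n -sumrMnl -!addrA; congr (_ + _)%R.
rewrite addrC; congr (_ + _)%R; apply: eq_bigr => i _.
by rewrite -mulrnA divnK // prime_dvd_bin //= ltnS ltn_ord.
Qed.

(** Pairwise commutation is assumed explicitly because [group_ring] is not a commutative ring; it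
    holds for elements supported on an abelian group. *)
Lemma expr_sum_prime_comm (R : nzRingType) (q : nat) (I : Type) (r : seq I)
    (F : I -> R) :
  prime q -> (forall i j, GRing.comm (F i) (F j)) ->
  exists c, ((\sum_(i <- r) F i) ^+ q = \sum_(i <- r) F i ^+ q + c *+ q)%R.
Proof.
move=> q_pr cF; elim: r => [|i r [c IHr]].
  exists 0%R; rewrite !big_nil mul0rn addr0 expr0n.
  by case: q q_pr.
rewrite !big_cons.
have [|d ->] := @exprD_prime_comm _ _ (F i) (\sum_(j <- r) F j)%R q_pr.
  by apply: commr_sum => j _; apply: cF.
by exists (c + d)%R; rewrite IHr mulrnDl !addrA.
Qed.

Section Frobenius.

Variables (gT : finGroupType) (G : {group gT}) (S : {set gT}) (q : nat).
Hypotheses (cGG : abelian G) (sSG : S \subset G) (q_pr : prime q).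

Lemma simple_quantity_expr_prime :
  exists c, (simple_quantity S ^+ q = push_forward (expgn^~ q) S + c *+ q)%R.
Proof.
pose F x := if x \in S then simple_quantity [set x] else 0%R.
have sumF : (\sum_x F x)%R = simple_quantity S.
  by rewrite -big_mkcond simple_quantityE.
have cF x y : GRing.comm (F x) (F y).
  rewrite /F; case: ifP => Sx; last exact: commr0 || (apply/commr_sym/commr0).
  case: ifP => Sy; last exact: commr0.
  rewrite /GRing.comm !simple_quantity1M.
  by rewrite (centsP cGG) ?(subsetP sSG).
have [c] := expr_sum_prime_comm (index_enum gT) q_pr cF.
rewrite sumF => ->; exists c; congr (_ + _)%R.
rewrite push_forwardE [RHS]big_mkcond; apply: eq_bigr => x _; rewrite /F.
case: ifP => _; first by rewrite simple_quantity1X.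
by rewrite expr0n; case: q q_pr.
Qed.

Lemma simple_quantity_expr_prime_mod g :
  exists d : int, ((simple_quantity S ^+ q)%R g
    = #|[set x in S | x ^+ q == g]%g|%:R + d *+ q)%R.
Proof.
have [c ->] := simple_quantity_expr_prime; exists (c g).
by rewrite ffunE group_ring_mulrnE ffunE.
Qed.

End Frobenius.

(** * Unions of basic sets *)

(** A combination of class sums is a function supported on D and constant on classes, its
    coefficients being its values. This turns membership in an S-ring into a pointwise condition. *)
Lemma span_partitionP (gT : finGroupType) (a : group_ring gT)
    (Q : {set {set gT}}) (D : {set gT}) :
  partition Q D ->
  (exists c : {set gT} -> int, a = (\sum_(X in Q) simple_quantity X *~ c X)%R) <->
  (forall x, x \notin D -> a x = 0%R) /\
  (forall X x y, X \in Q -> x \in X -> y \in X -> a x = a y).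
Proof.
case/and3P=> /eqP covQ trivQ nQ0.
have sumE (c : {set gT} -> int) x :
    (\sum_(X in Q) simple_quantity X *~ c X)%R x
      = if x \in D then c (pblock Q x) else 0%R.
  rewrite group_ring_sumE -covQ; case: ifP => Qx; last first.
    rewrite big1 // => X QX; rewrite group_ring_mulrzE ffunE.
    case: (boolP (x \in X)) => [Xx|]; last by rewrite mul0r.
    by case/bigcupP: Qx; exists X.
  rewrite (bigD1 (pblock Q x)) ?pblock_mem //= group_ring_mulrzE ffunE.
  rewrite mem_pblock Qx mul1r big1 ?addr0 // => X /andP[QX ne_X].
  rewrite group_ring_mulrzE ffunE; case: (boolP (x \in X)) => [Xx|].
    by rewrite (def_pblock trivQ QX Xx) eqxx in ne_X.
  by rewrite mul0r.
split=> [[c ->] | [a0 aK]].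
  split=> [x /negbTE nDx | X x y QX Xx Xy]; first by rewrite sumE nDx.
  rewrite !sumE (def_pblock trivQ QX Xx) (def_pblock trivQ QX Xy) -covQ.
  by do 2![case: bigcupP => [_|[]]; last by exists X].
exists (fun X => a (repr X)); apply/ffunP=> x; rewrite sumE.
case: ifP => Dx; last by rewrite a0 ?Dx.
have Qx : x \in pblock Q x by rewrite mem_pblock covQ.
apply: (aK (pblock Q x)) => //; first by rewrite pblock_mem ?covQ.
exact: mem_repr Qx.
Qed.

Section BasicSets.

Variables (gT : finGroupType) (G : {group gT}) (A : sring G).
Implicit Types (S T X : {set gT}) (a b : group_ring gT).

Definition basic_set x := pblock (basic_sets A) x.

Lemma trivIset_basic : trivIset (basic_sets A).
Proof. by case/and3P: (basic_partition A). Qed.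

Lemma cover_basic : cover (basic_sets A) = G.
Proof. exact: cover_partition (basic_partition A). Qed.

Lemma basic_setP x : x \in G -> basic_set x \in basic_sets A.
Proof. by move=> Gx; rewrite pblock_mem // cover_basic. Qed.

Lemma mem_basic_set x : x \in G -> x \in basic_set x.
Proof. by move=> Gx; rewrite mem_pblock cover_basic. Qed.

Lemma basic_set_eq x y : y \in basic_set x -> basic_set y = basic_set x.
Proof. exact: same_pblock trivIset_basic. Qed.

Lemma basic_set_def X x : X \in basic_sets A -> x \in X -> basic_set x = X.
Proof. exact: def_pblock trivIset_basic. Qed.

Lemma basic_setsP X :
  reflect (exists2 x, x \in G & X = basic_set x) (X \in basic_sets A).
Proof.
apply: (iffP idP) => [bX | [x Gx ->]]; last exact: basic_setP.
have /set0Pn[x Xx]: X != set0.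
  by apply: contraTneq bX => ->; case/and3P: (basic_partition A).
exists x; last by rewrite (basic_set_def bX Xx).
by rewrite -cover_basic; apply/bigcupP; exists X.
Qed.

Lemma basic_set_sub x : basic_set x \subset G.
Proof.
apply/subsetP=> y; rewrite -cover_basic -!mem_pblock.
by move=> xy; rewrite -/(basic_set y) (basic_set_eq xy).
Qed.

Lemma basic_set_sym x y : x \in G -> y \in basic_set x -> x \in basic_set y.
Proof. by move=> Gx /basic_set_eq->; apply: mem_basic_set. Qed.

Lemma basic_set1 : basic_set 1 = [set 1].
Proof. exact: basic_set_def (basic_1 A) (set11 1). Qed.

Lemma sring_predP a :
  a \in sring_pred A <->
  (forall x, x \notin G -> a x = 0%R) /\
  (forall x y, x \in G -> y \in basic_set x -> a y = a x).
Proof.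
split=> [/sring_span/(span_partitionP _ (basic_partition A))[a0 aK] | [a0 aK]].
  split=> // x y Gx xy; apply: aK (basic_setP Gx) xy (mem_basic_set Gx).
apply/sring_span/(span_partitionP _ (basic_partition A)); split=> // X x y.
case/basic_setsP=> z Gz -> zx zy; by rewrite !(aK z).
Qed.

(** Boolean form of being a union of basic sets; [sring_subgroupP] converts it to the official
    notion for subgroups. *)
Definition sring_set S := (S \subset G) && [forall x in S, basic_set x \subset S].

Lemma sring_setP S :
  reflect (S \subset G /\ forall x y, x \in S -> y \in basic_set x -> y \in S)
          (sring_set S).
Proof.
apply: (iffP andP) => -[sSG].
  move/'forall_implyP => clS; split=> // x y Sx xy.
  exact: (subsetP (clS x Sx)).
move=> clS; split=> //; apply/forall_inP => x Sx; apply/subsetP => y.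
exact: clS.
Qed.

Lemma sring_setS S : sring_set S -> S \subset G.
Proof. by case/sring_setP. Qed.

Lemma sring_set_closed S x y :
  sring_set S -> x \in S -> y \in basic_set x -> y \in S.
Proof. by case/sring_setP=> _; apply. Qed.

Lemma sring_set_sub S x : sring_set S -> x \in S -> basic_set x \subset S.
Proof. by move=> AS Sx; apply/subsetP=> y; apply: sring_set_closed. Qed.

Lemma mem_sring_set S x y :
  sring_set S -> x \in G -> y \in basic_set x -> (y \in S) = (x \in S).
Proof.
move=> AS Gx xy; apply/idP/idP => [Sy | Sx]; last exact: sring_set_closed xy.
exact: sring_set_closed (basic_set_sym Gx xy).
Qed.

Lemma sring_set_quantity S : sring_set S <-> simple_quantity S \in sring_pred A.
Proof.
split=> [AS | /sring_predP[S0 SK]].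
  apply/sring_predP; split=> [x nGx | x y Gx xy]; rewrite !ffunE.
    by case: (boolP (x \in S)) => // /(subsetP (sring_setS AS)); rewrite (negbTE nGx).
  by rewrite (mem_sring_set AS Gx).
have sSG: S \subset G.
  apply/subsetP=> x Sx; apply: contraT => /S0; rewrite ffunE Sx.
  by move/eqP; rewrite oner_eq0.
apply/sring_setP; split=> // x y Sx xy.
have:= SK x y (subsetP sSG _ Sx) xy; rewrite !ffunE Sx.
by case: (y \in S) => // /eqP; rewrite eq_sym oner_eq0.
Qed.

(** The Schur-Wielandt principle: an element of the S-ring is constant on basic sets, so any
    condition on its coefficients cuts out a union of basic sets. *)
Lemma sring_set_level a (q : pred int) :
  a \in sring_pred A -> sring_set [set x in G | q (a x)].
Proof.
case/sring_predP=> _ aK; apply/sring_setP; split.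
  by apply/subsetP=> x; rewrite inE => /andP[].
move=> x y; rewrite !inE => /andP[Gx qx] xy.
by rewrite (aK x y Gx xy) qx (subsetP (basic_set_sub x) _ xy).
Qed.

Lemma sring_set_basic x : sring_set (basic_set x).
Proof.
apply/sring_setP; split=> [|y z xy]; first exact: basic_set_sub.
by rewrite (basic_set_eq xy).
Qed.

Lemma sring_set1 : sring_set 1.
Proof. by rewrite -[1]basic_set1 sring_set_basic. Qed.

Lemma sring_setU S T : sring_set S -> sring_set T -> sring_set (S :|: T).
Proof.
move=> AS AT; apply/sring_setP; split.
  by rewrite subUset !sring_setS.
move=> x y /setUP[Sx | Tx] xy; rewrite inE.
  by rewrite (sring_set_closed AS Sx xy).
by rewrite (sring_set_closed AT Tx xy) orbT.
Qed.

Lemma sring_setI S T : sring_set S -> sring_set T -> sring_set (S :&: T).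
Proof.
move=> AS AT; apply/sring_setP; split.
  by rewrite subIset // sring_setS.
move=> x y /setIP[Sx Tx] xy; rewrite inE.
by rewrite (sring_set_closed AS Sx xy) (sring_set_closed AT Tx xy).
Qed.

Lemma sring_set_inv S : sring_set S -> sring_set S^-1.
Proof.
move=> AS; apply/sring_setP; split; first by rewrite -[G : {set _}]invGid invSg sring_setS.
move=> x y; rewrite !inE => Sx xy; apply: (sring_set_closed AS Sx).
have Gx: x \in G by rewrite -groupV (subsetP (sring_setS AS)).
have bV := basic_inv (basic_setP Gx).
rewrite (basic_set_def bV (x := x^-1)) inE ?invgK //.
exact: mem_basic_set.
Qed.

Lemma sring_predM a b :
  a \in sring_pred A -> b \in sring_pred A -> (a * b)%R \in sring_pred A.
Proof. by case: (sring_subring A) => _ _; apply. Qed.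

Lemma sring_predX a n : a \in sring_pred A -> (a ^+ n)%R \in sring_pred A.
Proof.
move=> Aa; elim: n => [|n IHn]; last by rewrite exprS sring_predM.
by case: (sring_subring A).
Qed.

Lemma card_mul_basic S T x y :
    sring_set S -> sring_set T -> x \in G -> y \in basic_set x ->
  #|[set s in S | s^-1 * y \in T]| = #|[set s in S | s^-1 * x \in T]|.
Proof.
move=> /sring_set_quantity AS /sring_set_quantity AT Gx xy.
have /sring_predP[_ /(_ x y Gx xy)] := sring_predM AS AT.
by rewrite !simple_quantity_mulE => /eqP; rewrite eqr_nat => /eqP.
Qed.

Lemma sring_setM S T : sring_set S -> sring_set T -> sring_set (S * T).
Proof.
move=> AS AT.
have -> : S * T = [set x in G | #|[set s in S | s^-1 * x \in T]| != 0].
  apply/setP=> x; rewrite inE; apply/idP/andP.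
    case/mulsgP=> s t Ss Tt ->; split.
      by rewrite groupM // ?(subsetP (sring_setS AS) s) ?(subsetP (sring_setS AT) t).
    rewrite cards_eq0; apply/set0Pn; exists s; rewrite inE Ss mulKg; exact: Tt.
  case=> _; rewrite cards_eq0 => /set0Pn[s]; rewrite inE => /andP[Ss Tsx].
  by rewrite -(mulKVg s x) mem_mulg.
apply/sring_setP; split; first by apply/subsetP=> x; rewrite inE => /andP[].
move=> x y; rewrite !inE => /andP[Gx nx] xy.
by rewrite (card_mul_basic AS AT Gx xy) nx (subsetP (basic_set_sub x)).
Qed.

(** The intersection number is the coefficient of x in the product of S and the inverse of T. It is
    mostly applied with T a subgroup, where it counts the points of S in a coset. *)
Lemma card_lcoset_basic S T x y :
    sring_set S -> sring_set T -> x \in G -> y \in basic_set x ->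
  #|S :&: y *: T| = #|S :&: x *: T|.
Proof.
move=> AS AT Gx xy; have:= card_mul_basic AS (sring_set_inv AT) Gx xy.
have E z : [set s in S | s^-1 * z \in T^-1] = S :&: z *: T.
  by apply/setP=> s; rewrite !inE mem_lcoset invMg invgK.
by rewrite !E.
Qed.

Lemma sring_set_gen S : sring_set S -> sring_set <<S>>.
Proof.
move=> AS.
have sSG: <<S>> \subset G by rewrite gen_subG sring_setS.
(* T is closed under products because the product of the basic sets of x and y is a union of basic
   sets containing x y. Since T contains S, it contains [<<S>>]. *)
pose T := [set x in G | basic_set x \subset <<S>>].
have gT' : group_set T.
  apply/group_setP; split=> [|x y].
    by rewrite inE group1 basic_set1 sub1set group1.
  rewrite !inE => /andP[Gx sx] /andP[Gy sy]; rewrite groupM //=.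
  apply: subset_trans (mul_subG sx sy).
  apply: sring_set_sub; first by rewrite sring_setM ?sring_set_basic.
  by rewrite mem_mulg ?mem_basic_set.
have sgT : <<S>> \subset T.
  rewrite (_ : T = Group gT') // gen_subG; apply/subsetP=> x Sx; rewrite inE.
  rewrite (subsetP (sring_setS AS)) //=.
  exact: subset_trans (sring_set_sub AS Sx) (subset_gen S).
apply/sring_setP; split=> // x y Sx xy.
by have:= subsetP sgT x Sx; rewrite inE => /andP[_ /subsetP->].
Qed.

(** An element x stabilizes S exactly when |S ∩ xS| = |S|, and this number is constant on basic
    sets. *)
Lemma sring_set_stab S : sring_set S -> sring_set [set x in G | x *: S == S].
Proof.
move=> AS; apply/sring_setP; split.
  by apply/subsetP=> x; rewrite inE => /andP[].
have E x : (x *: S == S) = (#|S :&: x *: S| == #|S|).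
  apply/eqP/eqP => [-> | e]; first by rewrite setIid.
  have/setIidPl sS : S :&: x *: S = S.
    by apply/eqP; rewrite eqEcard subsetIl e leqnn.
  by apply/esym/eqP; rewrite eqEcard sS card_lcoset leqnn.
move=> x y; rewrite !inE !E => /andP[Gx nx] xy.
by rewrite (card_lcoset_basic AS AS Gx xy) nx (subsetP (basic_set_sub x)).
Qed.

Lemma sring_subgroupP (U : {group gT}) : sring_set U -> sring_subgroup A U.
Proof.
move=> AU; split; first exact: sring_setS.
exists [set X in basic_sets A | X \subset U].
  by apply/subsetP=> X; rewrite inE => /andP[].
apply/setP=> x; apply/idP/bigcupP => [Ux | [X]].
  have Gx := subsetP (sring_setS AU) x Ux.
  by exists (basic_set x); rewrite ?mem_basic_set // inE basic_setP // sring_set_sub.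
by rewrite inE => /andP[_ /subsetP]; apply.
Qed.

Lemma subring_closed_supported (U : {group gT}) :
  subring_closed
    [pred a | (a \in sring_pred A) && [forall x, (x \notin U) ==> (a x == 0%R)]].
Proof.
have [A1 AB AM] := sring_subring A.
split=> [|a b|a b]; rewrite !inE.
- rewrite A1; apply/forall_inP=> x nUx; rewrite ffunE.
  by case: (x =P 1%g) nUx => // ->; rewrite group1.
- case/andP=> Aa /forall_inP a0 /andP[Ab /forall_inP b0]; rewrite AB //.
  by apply/forall_inP=> x nUx; rewrite !ffunE (eqP (a0 x nUx)) (eqP (b0 x nUx)) subr0.
case/andP=> Aa /forall_inP a0 /andP[Ab /forall_inP b0]; rewrite AM //.
apply/forall_inP=> x nUx; rewrite group_ring_mulE big1 // => y _.
have [Uy | nUy] := boolP (y \in U); last by rewrite (eqP (a0 y nUy)) mul0r.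
by rewrite (eqP (b0 _ _)) ?mulr0 // groupMl ?groupV.
Qed.

(** The S-ring induced on an A-subgroup; it supplies the two factors of the tensor product. *)
Lemma exists_sring_restriction (U : {group gT}) : sring_set U ->
  exists B : sring U, basic_sets B = [set X in basic_sets A | X \subset U].
Proof.
move=> AU; set Q := [set X in basic_sets A | X \subset U].
have covQ : cover Q = U.
  apply/setP=> x; apply/bigcupP/idP => [[X] | Ux].
    by rewrite inE => /andP[_ /subsetP]; apply.
  have Gx := subsetP (sring_setS AU) x Ux.
  by exists (basic_set x); rewrite ?mem_basic_set // inE basic_setP // sring_set_sub.
have partQ : partition Q U.
  apply/and3P; split; first exact/eqP.
    by apply: trivIsetS trivIset_basic; apply/subsetP=> X; rewrite inE => /andP[].
  by rewrite inE negb_and; case/and3P: (basic_partition A) => _ _ ->.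
have Q1 : [set 1] \in Q by rewrite inE basic_1 sub1set group1.
have QV X : X \in Q -> X^-1 \in Q.
  by rewrite !inE => /andP[bX sXU]; rewrite basic_inv // -[U : {set _}]invGid invSg.
have spanQ a : a \in [pred a | (a \in sring_pred A) &&
    [forall x, (x \notin U) ==> (a x == 0%R)]] <->
    exists c : {set gT} -> int, a = (\sum_(X in Q) simple_quantity X *~ c X)%R.
  split.
    rewrite inE => /andP[/sring_predP[_ aK] /forall_inP a0].
    apply/(span_partitionP _ partQ); split=> [x /a0/eqP // | X x y].
    rewrite inE => /andP[bX _] Xx Xy; apply: aK; last by rewrite (basic_set_def bX Xy).
    by rewrite -cover_basic; apply/bigcupP; exists X.
  case/(span_partitionP _ partQ) => a0 aK; rewrite inE; apply/andP; split; last first.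
    by apply/forall_inP=> x /a0 ->.
  apply/sring_predP; split=> [x nGx | x y Gx xy].
    by apply: a0; apply: contraNN nGx; apply: (subsetP (sring_setS AU)).
  have [Ux | nUx] := boolP (x \in U).
    apply: (aK (basic_set x)); rewrite ?mem_basic_set //.
    by rewrite inE basic_setP // sring_set_sub.
  by rewrite !a0 // (mem_sring_set AU Gx xy).
by exists (SRing (subring_closed_supported U) partQ Q1 QV spanQ).
Qed.

End BasicSets.

(** * Schur's theorem on multipliers *)

Section Multipliers.

Variables (gT : finGroupType) (G : {group gT}) (A : sring G).
Hypothesis cGG : abelian G.
Implicit Types (S T X : {set gT}).

(** The q-th power of the sum of S lies in the S-ring, and modulo q it is the sum of the q-th powers
    of the elements of S. So this set is where a ring element is nonzero modulo q. *)
Lemma sring_set_expg_prime S q :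
    prime q -> sring_set A S ->
  sring_set A [set x in G | ~~ (q %| #|[set s in S | s ^+ q == x]|)].
Proof.
move=> q_pr AS; have sSG := sring_setS AS.
have Aq := sring_predX q (proj1 (sring_set_quantity A S) AS).
rewrite (_ : [set x in G | _] = [set x in G | ~~ (q %| (simple_quantity S ^+ q)%R x)%Z]).
  exact: (sring_set_level (fun n => ~~ (q %| n)%Z)).
apply/setP=> x; rewrite !inE; congr (_ && ~~ _).
have [d ->] := simple_quantity_expr_prime_mod cGG sSG q_pr x.
rewrite rpredDr; first by rewrite natz.
by rewrite -mulr_natr natz dvdz_mull.
Qed.

(** The power map is injective, so its fibres have at most one element and indivisibility by q just
    means being in the image. *)
Lemma sring_set_expg_coprime_prime S q :
    prime q -> coprime #|G| q -> sring_set A S ->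
  sring_set A [set s ^+ q | s in S].
Proof.
move=> q_pr co_q AS; have sSG := subsetP (sring_setS AS).
have -> : [set s ^+ q | s in S]
          = [set x in G | ~~ (q %| #|[set s in S | s ^+ q == x]|)].
  apply/setP=> x; rewrite inE; apply/imsetP/andP => [[s Ss ->{x}] | [_]].
    rewrite groupX ?sSG //; split=> //.
    rewrite (_ : [set _ in S | _] = [set s]).
      by rewrite cards1 dvdn1 neq_ltn prime_gt1 ?orbT.
    apply/setP=> t; rewrite !inE; apply/andP/eqP => [[St /eqP e]|->]; last by [].
    by rewrite -(expgK co_q (sSG t St)) /= e expgK ?sSG.
  case: (set_0Vmem [set s in S | s ^+ q == x]) => [->|[s]].
    by rewrite cards0 dvdn0.
  by rewrite inE => /andP[Ss /eqP<-] _; exists s.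
exact: sring_set_expg_prime.
Qed.

Lemma sring_set_expg S n :
  coprime #|G| n -> sring_set A S -> sring_set A [set s ^+ n | s in S].
Proof.
have [m] := ubnP n; elim: m => // m IHm in n S *; rewrite ltnS => le_nm co_n AS.
have [n_gt1 | n_le1] := ltnP 1 n; last first.
  case: n n_le1 co_n {le_nm} => [|[|//]] _.
    (* Zero is coprime to |G| only when G is trivial. *)
    rewrite /coprime gcdn0 => /eqP/card1_trivg G1.
    have:= sring_setS AS; rewrite G1 subset1 => /orP[]/eqP->; last first.
      by rewrite imset0; apply/sring_setP; split=> [|x y]; rewrite ?sub0set ?inE.
    by rewrite imset_set1 expg0; apply: sring_set1.
  by move=> _; rewrite (_ : [set _ | _ in S] = S) // -[RHS]imset_id; apply: eq_imset.
pose q := pdiv n; have q_pr : prime q by rewrite pdiv_prime.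
have q_dv : q %| n by apply: pdiv_dvd.
have -> : [set s ^+ n | s in S] = [set t ^+ q | t in [set s ^+ (n %/ q) | s in S]].
  by rewrite -imset_comp; apply: eq_imset => s /=; rewrite -expgM divnK.
apply: sring_set_expg_coprime_prime; rewrite ?(coprime_dvdr q_dv) //.
apply: IHm => //; last by rewrite (coprime_dvdr _ co_n) ?dvdn_div.
by apply: leq_trans le_nm; rewrite ltn_Pdiv ?prime_gt1 // ltnW.
Qed.

(** The inverse exponent carries the basic set of x^n to an A-set containing x, hence y; taking n-th
    powers then returns to the basic set of x^n. *)
Lemma basic_set_expg x y n :
    coprime #|G| n -> x \in G -> y \in basic_set A x ->
  y ^+ n \in basic_set A (x ^+ n).
Proof.
move=> co_n Gx xy.
have Gy : y \in G by apply: (subsetP (basic_set_sub A x)).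
have co_m : coprime #|G| (expg_invn G n).
  have: coprime #|G| (n * expg_invn G n).
    rewrite -coprime_modr (_ : _ %% _ = 1 %% #|G|) ?coprime_modr ?coprimen1 //.
    by rewrite -(chinese_modl co_n 1 0) /chinese mul1n addn0 mulnC.
  by rewrite coprimeMr => /andP[].
have AS := sring_set_expg co_m (sring_set_basic A (x ^+ n)).
have: y \in [set s ^+ expg_invn G n | s in basic_set A (x ^+ n)].
  apply: sring_set_closed AS _ xy; apply/imsetP; exists (x ^+ n).
    by rewrite mem_basic_set ?groupX.
  exact/esym/expgK.
case/imsetP=> s xs ->; rewrite -expgM mulnC expgM.
by rewrite expgK // (subsetP (basic_set_sub A (x ^+ n))).
Qed.

End Multipliers.

(** * Colourings of C_3 x C_3 *)

(* Elements of C_3 x C_3 are coded by k < 9, standing for (k %/ 3, k %% 3).   *)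
Definition sub9 w k :=
  ((w %/ 3 + (3 - k %/ 3)) %% 3 * 3 + (w %% 3 + (3 - k %% 3)) %% 3)%N.

Definition add9 k l :=
  ((k %/ 3 + l %/ 3) %% 3 * 3 + (k %% 3 + l %% 3) %% 3)%N.

(** The endomorphism sending the basis vectors coded by 3 and 1 to x and y. *)
Definition lin9 x y k := iter (k %/ 3) (add9 x) (iter (k %% 3) (add9 y) 0).

Lemma add9_lt k l : add9 k l < 9.
Proof.
rewrite /add9 (@leq_trans (2 * 3 + 3)) // -addnS leq_add ?leq_mul2r //.
  by rewrite -ltnS ltn_mod.
by rewrite ltn_mod.
Qed.

Lemma lin9_lt x y k : lin9 x y k < 9.
Proof.
have iter_lt n z l : l < 9 -> iter n (add9 z) l < 9.
  by case: n => //= n _; apply: add9_lt.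
by rewrite /lin9 !iter_lt.
Qed.

Lemma sub9_lt w k : sub9 w k < 9.
Proof.
rewrite /sub9 (@leq_trans (2 * 3 + 3)) // -addnS leq_add ?leq_mul2r //.
  by rewrite -ltnS ltn_mod.
by rewrite ltn_mod.
Qed.

Definition sub9_table :=
  Eval vm_compute in [seq [seq sub9 w k | k <- iota 0 9] | w <- iota 0 9].

Definition lin9_table :=
  Eval vm_compute in
    [seq [seq lin9 x y k | k <- iota 0 9] | x <- iota 0 9, y <- iota 0 9].

(* [all], [has] and [count] evaluate both arguments of [&&] and [||] under    *)
(* call by value; these variants do not.                                      *)
Fixpoint short_all (T : Type) (P : pred T) (s : seq T) :=
  if s is x :: s' then if P x then short_all P s' else false else true.

Fixpoint short_has (T : Type) (P : pred T) (s : seq T) :=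
  if s is x :: s' then if P x then true else short_has P s' else false.

Fixpoint count_pair (s : seq (nat * nat)) i j :=
  if s is (k, l) :: s' then
    if k == i then if l == j then (count_pair s' i j).+1 else count_pair s' i j
    else count_pair s' i j
  else 0.

Lemma short_allE T (P : pred T) s : short_all P s = all P s.
Proof. by elim: s => //= x s ->. Qed.

Lemma short_hasE T (P : pred T) s : short_has P s = has P s.
Proof. by elim: s => //= x s ->. Qed.

Lemma count_pairE s i j : count_pair s i j = count_mem (i, j) s.
Proof. by elim: s => //= -[k l] s ->; rewrite xpair_eqE; do 2!case: eqP. Qed.

Fixpoint backtrack (cand : seq nat -> seq nat) n :=
  if n is n'.+1 then
    flatten [seq [seq rcons s v | v <- cand s] | s <- backtrack cand n']
  else [:: [::]].

(** Completeness of the search: nothing satisfying the constraints is missed, which is what a check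
    over all enumerated lists requires. *)
Lemma mem_backtrack cand s :
  (forall k, k < size s -> nth 0 s k \in cand (take k s)) ->
  s \in backtrack cand (size s).
Proof.
elim/last_ind: s => // s v IHs candP; rewrite size_rcons /=.
apply/flattenP; exists [seq rcons s w | w <- cand s].
  apply: (map_f (fun s' => [seq rcons s' w | w <- cand s'])); apply: IHs => k lt_ks.
  have := candP k; rewrite size_rcons nth_rcons lt_ks -cats1 takel_cat ?(ltnW lt_ks) //.
  by apply; rewrite ltnW.
apply: map_f; have := candP (size s); rewrite size_rcons nth_rcons ltnn eqxx.
by rewrite -cats1 take_size_cat //; apply.
Qed.

Lemma mem_zip_take (h : nat -> nat) (r : seq nat) m x y :
  (x, y) \in zip r (map h (take m r)) -> x \in r /\ y = h x.
Proof.
elim: r m => [|z r IHr] [|m] //=; rewrite !inE => /predU1P[[-> ->]|/IHr[rx ->]].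
  by rewrite eqxx.
by rewrite rx orbT.
Qed.

(* A colouring of C_3 x C_3 is coded by the list of the first elements of the *)
(* colour classes; 0 is required to be alone in its class.                    *)
Definition colourings :=
  backtrack (fun s => size s :: [seq v <- undup s | v != 0]) 9.

(** Entry w lists the colour pairs of the nine decompositions w = k + (w - k); multiplicities in it
    are the structure constants at w. *)
Definition colour_pairs (F : seq nat) :=
  [seq zip F [seq nth 0 F k | k <- r] | r <- sub9_table].

(** The structure constants at w are compared with those at the point naming its class. Only pairs
    occurring at w are tested; both lists have nine entries, so this already makes them equal as
    multisets. *)
Definition coherent F :=
  let pF := colour_pairs F in
  short_all (fun a => let b := nth [::] pF a.1 in
    short_all (fun ij => count_pair a.2 ij.1 ij.2 == count_pair b ij.1 ij.2) a.2)
    (zip F pF).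

Definition preserves_constants pF (l : seq (nat * nat)) :=
  short_all (fun k => let a := nth [::] pF k.1 in let b := nth [::] pF k.2 in
    short_all (fun i => short_all (fun j =>
      count_pair a i.1 j.1 == count_pair b i.2 j.2) l) l) l.

(** A list s holds the images of the first colours of r. Since [zip] truncates, a partial assignment
    is discarded as soon as it breaks a structure constant among the colours assigned so far. *)
Definition colour_isos F :=
  let pF := colour_pairs F in
  let r := undup F in
  backtrack (fun s => [seq v <- r |
    if v \in s then false else preserves_constants pF (zip r (rcons s v))]) (size r).

(** Maps in [good] respect the colours but are not tested for bijectivity; that follows in
    [colouring_iso_Aut] from the identity being alone in its class. *)
Definition induced_by_linear F t :=
  let tF := [seq nth 0 t (index k (undup F)) | k <- F] in
  let good := [seq l <- lin9_table |
                 short_all (fun kl => nth 0 F kl.1 == kl.2) (zip l tF)] in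
  short_all (fun w => short_all (fun w' =>
      if nth 0 F w' == nth 0 tF w then short_has (fun l => nth 0 l w == w') good
      else true)
    (iota 0 9)) (iota 0 9).

(** The finite core of the cyclotomic case, settled by enumeration: colour permutations preserving
    structure constants come from linear maps, which moreover can be made to match any two points of
    corresponding colours. *)
Lemma colour_isos_linear :
  short_all (fun F => if coherent F then
      short_all (induced_by_linear F) (colour_isos F) else true) colourings.
Proof. by vm_compute. Qed.

Section Colourings.

Variables (C : eqType) (f g : nat -> C).

Definition count_products (h : nat -> C) c1 c2 w :=
  count (fun k => (h k == c1) && (h (sub9 w k) == c2)) (iota 0 9).

Hypothesis f0 : forall k, k < 9 -> f k = f 0 -> k = 0.
Hypothesis fg : forall k l, k < 9 -> l < 9 -> (f k == f l) = (g k == g l).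
Hypothesis g_onto : forall k, k < 9 -> exists2 l, l < 9 & g l = f k.
Hypothesis f_coherent : forall w w' c1 c2, w < 9 -> w' < 9 -> f w = f w' ->
  count_products f c1 c2 w = count_products f c1 c2 w'.
Hypothesis fg_iso : forall w w' c1 c2, w < 9 -> w' < 9 -> f w = g w' ->
  count_products f c1 c2 w = count_products g c1 c2 w'.

(** A class is named by its least member. Since f and g have the same fibres by [fg], the g-class of
    colour f k is also named by a code, [image k]. An isomorphism from f to g thus becomes a
    permutation of the colours of the single list F. *)
Let code k := find (fun l => f l == f k) (iota 0 9).
Let F := map code (iota 0 9).
Let image k := find (fun l => g l == f k) (iota 0 9).

Let find_iota (P : pred nat) k : k < 9 -> P k ->
  [/\ find P (iota 0 9) < 9, find P (iota 0 9) <= k & P (find P (iota 0 9))].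
Proof.
move=> k9 Pk; have hasP : has P (iota 0 9) by apply/hasP; exists k; rewrite ?mem_iota.
have lt9 : find P (iota 0 9) < 9 by rewrite -[9](size_iota 0) -has_find.
split=> //; last by have := nth_find 0 hasP; rewrite nth_iota ?add0n.
rewrite leqNgt; apply/negP => /(before_find 0).
by rewrite nth_iota ?add0n ?Pk.
Qed.

Let codeP k : k < 9 -> [/\ code k < 9, code k <= k & f (code k) = f k].
Proof. by move=> k9; have [//|? ? /eqP] := @find_iota (fun l => f l == f k) k k9. Qed.

Let code_eq k l : k < 9 -> l < 9 -> (code k == code l) = (f k == f l).
Proof.
move=> k9 l9; apply/eqP/eqP => [e | e]; last by rewrite /code e.
by have [_ _ <-] := codeP k9; have [_ _ <-] := codeP l9; rewrite e.
Qed.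

Let code_code k : k < 9 -> code (code k) = code k.
Proof.
by move=> k9; have [ck9 _ e] := codeP k9; apply/eqP; rewrite code_eq // e.
Qed.

Let imageP k : k < 9 -> image k < 9 /\ g (image k) = f k.
Proof.
move=> k9; have [l l9 /eqP e] := g_onto k9.
by have [//|? ? /eqP] := @find_iota (fun l => g l == f k) l l9.
Qed.

Let image_code k l : k < 9 -> l < 9 -> (code k == image l) = (g k == f l).
Proof.
move=> k9 l9; have [i9 gi] := imageP l9; have [c9 _ fc] := codeP k9.
apply/eqP/eqP => [e | gk].
  apply/eqP; rewrite -gi -e -fg // -?code_eq //.
  by rewrite code_code.
by apply: eq_in_find => m; rewrite mem_iota /= => m9; rewrite fg // gk.
Qed.

Let nth_F k : k < 9 -> nth 0 F k = code k.
Proof. by move=> k9; rewrite (nth_map 0) ?size_iota // nth_iota. Qed.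

Let mem_F k : k \in F -> k < 9 /\ code k = k.
Proof.
case/mapP=> l; rewrite mem_iota /= => l9 ->; split; last exact: code_code.
by case: (codeP l9).
Qed.

Let F_colourings : F \in colourings.
Proof.
rewrite /colourings -[9]/(size F).
apply: mem_backtrack => k; rewrite size_map size_iota => k9; rewrite nth_F //.
have [c9 le_ck fc] := codeP k9.
rewrite inE size_takel ?size_map ?size_iota ?(ltnW k9) //.
case: (ltngtP (code k) k) le_ck => // lt_ck _; rewrite /= mem_filter mem_undup.
apply/andP; split.
  (* Position k repeats the class of an earlier point, which cannot be 0 because 0 is alone in its
     class. *)
  by apply: contraTneq lt_ck => c0; rewrite (@f0 k) // -fc c0.
rewrite -{1}(code_code k9) -(nth_F c9) -(nth_take 0 lt_ck) mem_nth //.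
by rewrite size_takel // size_map size_iota ltnW.
Qed.

Let nth_pairs w : w < 9 ->
  nth [::] (colour_pairs F) w = [seq (code k, code (sub9 w k)) | k <- iota 0 9].
Proof.
move=> w9; have tabE : sub9_table
   = [seq [seq sub9 w k | k <- iota 0 9] | w <- iota 0 9] by vm_compute.
rewrite (nth_map [::]) tabE ?size_map ?size_iota //.
rewrite (nth_map 0) ?size_iota // nth_iota // add0n -map_comp zip_map.
by apply: eq_map => k /=; rewrite nth_F ?sub9_lt.
Qed.

Let count_pairsE (h : nat -> C) (i j w : nat) c1 c2 : w < 9 ->
  (forall k, k < 9 -> (code k == i) = (h k == c1)) ->
  (forall k, k < 9 -> (code k == j) = (h k == c2)) ->
  count_pair (nth [::] (colour_pairs F) w) i j = count_products h c1 c2 w.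
Proof.
move=> w9 hi hj; rewrite nth_pairs // count_pairE count_map.
apply: eq_in_count => k; rewrite mem_iota /= => k9.
by rewrite /= xpair_eqE hi // hj // sub9_lt.
Qed.

Let coherent_F : coherent F.
Proof.
rewrite /coherent short_allE; apply/(all_nthP (0, [::])) => w.
have szp : size (colour_pairs F) = 9 by rewrite size_map.
rewrite size_zip size_map size_iota szp minnn => w9.
rewrite nth_zip ?size_map // nth_F // short_allE; apply/allP => -[i j].
change ((i, j) \in nth [::] (colour_pairs F) w ->
  count_pair (nth [::] (colour_pairs F) w) i j
    == count_pair (nth [::] (colour_pairs F) (code w)) i j) => ijw.
rewrite (nth_pairs w9) in ijw; case/mapP: ijw => k kI [-> ->].
have k9 : k < 9 by rewrite mem_iota in kI.
have [c9 _ fc] := codeP w9.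
have s9 := sub9_lt w k.
have E v (v9 : v < 9) : count_pair (nth [::] (colour_pairs F) v) (code k) (code (sub9 w k))
      = count_products f (f k) (f (sub9 w k)) v.
  by apply: count_pairsE => // l l9; rewrite code_eq.
by rewrite (E w w9) (E _ c9); apply/eqP/f_coherent.
Qed.

Let code_fixed k l : k < 9 -> l \in F -> (code k == l) = (f k == f l).
Proof. by move=> k9 /mem_F[l9 {1}<-]; rewrite code_eq. Qed.

Let t := map image (undup F).

Let code_image k : k < 9 -> code (image k) = image k.
Proof.
by move=> k9; have [i9 gi] := imageP k9; apply/eqP; rewrite image_code // gi.
Qed.

Let preserves_t l : (forall x, x \in l -> x.1 \in F /\ x.2 = image x.1) ->
  preserves_constants (colour_pairs F) l.
Proof.
move=> lP; rewrite /preserves_constants short_allE; apply/allP=> -[w w'] /lP[/= Fw ->].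
rewrite short_allE; apply/allP=> -[i i'] /lP[/= Fi ->].
rewrite short_allE; apply/allP=> -[j j'] /lP[/= Fj ->].
have [w9 _] := mem_F Fw; have [i9 _] := mem_F Fi; have [j9 _] := mem_F Fj.
have [iw9 giw] := imageP w9.
have Ef : count_pair (nth [::] (colour_pairs F) w) i j = count_products f (f i) (f j) w.
  by apply: count_pairsE => // k k9; apply: code_fixed.
have Eg : count_pair (nth [::] (colour_pairs F) (image w)) (image i) (image j)
    = count_products g (f i) (f j) (image w).
  by apply: count_pairsE => // k k9; apply: image_code.
by rewrite Ef Eg; apply/eqP/fg_iso.
Qed.

Let t_isos : t \in colour_isos F.
Proof.
rewrite /colour_isos -[size _](size_map image) -/t; apply: mem_backtrack => k.
rewrite size_map => k_lt; rewrite (nth_map 0) //.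
have Fk : nth 0 (undup F) k \in F by rewrite -mem_undup mem_nth.
have [r9 cr] := mem_F Fk; have [i9 gi] := imageP r9.
rewrite mem_filter mem_undup andbC; apply/andP; split.
  by rewrite -(code_image r9) map_f // mem_iota.
have tkE : take k t = map image (take k (undup F)) by rewrite map_take.
case: ifPn => [| _].
  rewrite tkE => /mapP[l tl e].
  have Fl : l \in F by rewrite -mem_undup (mem_take tl).
  have [l9 cl] := mem_F Fl; have [_ gl] := imageP l9.
  have el : nth 0 (undup F) k = l.
    by rewrite -cr -cl; apply/eqP; rewrite code_eq // -gl -gi e.
  have := undup_uniq F; rewrite -(cat_take_drop k (undup F)) cat_uniq.
  case/and3P=> _ /hasPn /(_ l) + _; rewrite /= tl => /implyP; rewrite implybF => /negP[].
  by rewrite -el (drop_nth 0 k_lt) mem_head.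
apply: preserves_t => -[x y]; rewrite tkE -map_rcons -take_nth //.
by case/mem_zip_take; rewrite mem_undup.
Qed.

Lemma colouring_iso_linear w w' : w < 9 -> w' < 9 -> f w = g w' ->
  exists x y, [/\ x < 9, y < 9, lin9 x y w = w' &
    forall k, k < 9 -> f k = g (lin9 x y k)].
Proof.
move=> w9 w9' e; have := colour_isos_linear; rewrite short_allE.
move/allP=> /(_ F F_colourings); rewrite coherent_F short_allE => /allP/(_ t t_isos).
rewrite /induced_by_linear.
have -> : [seq nth 0 t (index k (undup F)) | k <- F] = map image (iota 0 9).
  rewrite {2}/F -map_comp; apply/eq_in_map => k; rewrite mem_iota => k9.
  rewrite [LHS]/=.
  have Fk : code k \in undup F by rewrite mem_undup map_f ?mem_iota.
  rewrite (nth_map 0) ?index_mem // nth_index //.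
  by have [_ _ fc] := codeP k9; rewrite /image fc.
set good := [seq l <- lin9_table | _].
rewrite short_allE => /allP/(_ w); rewrite mem_iota => /(_ w9).
rewrite short_allE => /allP/(_ w'); rewrite mem_iota => /(_ w9').
rewrite nth_F // (nth_map 0) ?size_iota // nth_iota // add0n.
rewrite image_code // -e eqxx short_hasE => /hasP[l].
have tabE : lin9_table
   = [seq [seq lin9 x y k | k <- iota 0 9] | x <- iota 0 9, y <- iota 0 9] by vm_compute.
rewrite mem_filter tabE => /andP[+ /allpairsP[[x y] [xI yI lE]]].
rewrite {}lE -[(x, y).1]/x -[(x, y).2]/y in xI yI *.
rewrite short_allE zip_map all_map => /allP lP.
rewrite (nth_map 0) ?size_iota // nth_iota // add0n => /eqP lw.
rewrite !mem_iota in xI yI; exists x, y; split=> // k k9.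
have := lP k; rewrite mem_iota => /(_ k9) /=.
have l9 := lin9_lt x y k.
by rewrite nth_F // image_code // => /eqP.
Qed.

End Colourings.

Lemma add9_sub9 k w : k < 9 -> w < 9 -> add9 k (sub9 w k) = w.
Proof.
move=> k9 w9.
have /allP/(_ k) : all (fun k => all (fun w => add9 k (sub9 w k) == w) (iota 0 9))
                       (iota 0 9) by vm_compute.
by rewrite mem_iota => /(_ k9) /allP/(_ w); rewrite mem_iota => /(_ w9) /eqP.
Qed.

(** * Transport of the finite check to an elementary abelian group of order 9 *)

Section ElementaryAbelian9.

Variables (gT : finGroupType) (E : {group gT}).
Hypotheses (cEE : abelian E) (cardE9 : #|E| = 9).
Hypothesis expE : forall x, x \in E -> x ^+ 3 = 1.

Let word (x y : gT) k := x ^+ (k %/ 3) * y ^+ (k %% 3).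

Lemma word_mem x y k : x \in E -> y \in E -> word x y k \in E.
Proof. by move=> Ex Ey; rewrite groupM ?groupX. Qed.

Lemma word_add9 x y k l : x \in E -> y \in E ->
  word x y (add9 k l) = word x y k * word x y l.
Proof.
move=> Ex Ey; have cxy : commute x y by apply: (centsP cEE).
rewrite /word /add9 divnMDl // [_ %% 3 %/ 3]divn_small ?ltn_mod // addn0.
rewrite modnMDl modn_mod !expg_mod ?expE // !expgD !expg_mod ?expE // !mulgA; congr (_ * _).
by rewrite -!mulgA; congr (_ * _); apply: commuteX2.
Qed.

Lemma word_lin9 x y k l m : x \in E -> y \in E ->
  word x y (lin9 k l m) = word (word x y k) (word x y l) m.
Proof.
move=> Ex Ey; have iterE n z i :
    word x y (iter n (add9 z) i) = word x y z ^+ n * word x y i.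
  by elim: n => [|n IHn] /=; rewrite ?mul1g // word_add9 // IHn expgS mulgA.
have w0 : word x y 0 = 1 by rewrite /word mulg1.
by rewrite /lin9 !iterE w0 mulg1.
Qed.

Lemma exists_basis9 : exists a b, [/\ a \in E, b \in E &
  {in gtn 9 &, injective (word a b)}].
Proof.
have ntE : E :!=: 1 by rewrite -cardG_gt1 cardE9.
have [a Ea nt_a] := trivgPn _ ntE.
have oa : #[a] = 3 by apply: nt_prime_order => //; apply: expE.
have /subsetPn[b Eb nab] : ~~ (E \subset <[a]>).
  by apply/negP => /subset_leq_card; rewrite cardE9 -orderE oa.
exists a, b; split=> // k l; rewrite !inE => k9 l9 e.
have ob : #[b] = 3.
  apply: nt_prime_order => //; first exact: expE.
  by apply: contraNneq nab => ->; apply: group1.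
have tiab : <[a]> :&: <[b]> = 1.
  by rewrite setIC; apply: prime_TIg; rewrite -?orderE ?ob // cycle_subG.
have cab : commute a b by apply: (centsP cEE).
have e' : (a ^+ (l %/ 3))^-1 * a ^+ (k %/ 3) = b ^+ (l %% 3) * (b ^+ (k %% 3))^-1.
  by apply: (mulIg (b ^+ (k %% 3))); rewrite mulgKV -mulgA [_ * b ^+ _]e mulKg.
have : (a ^+ (l %/ 3))^-1 * a ^+ (k %/ 3) \in <[a]> :&: <[b]>.
  by rewrite inE {2}e' !groupM ?groupV ?mem_cycle.
rewrite tiab => /set1P e1; move/eqP: e1 (e1); rewrite -eq_mulVg1 => /eqP ea.
rewrite e' => /eqP; rewrite -eq_mulgV1 => /eqP eb.
have lt3 m : m < 9 -> m %/ 3 < 3 by move=> m9; rewrite ltn_divLR.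
move/eqP: ea; rewrite eq_expg_mod_order oa !modn_small ?lt3 // => /eqP ea.
move/eqP: eb; rewrite eq_expg_mod_order ob !modn_mod => /eqP eb.
by rewrite (divn_eq k 3) (divn_eq l 3) ea eb.
Qed.

Variables (C : eqType) (f g : gT -> C).

Definition fibre_products (h : gT -> C) c1 c2 w :=
  #|[set x in E | (h x == c1) && (h (x^-1 * w) == c2)]|.

Hypothesis f1 : forall x, x \in E -> f x = f 1 -> x = 1.
Hypothesis fg : {in E &, forall x y, (f x == f y) = (g x == g y)}.
Hypothesis g_onto : forall x, x \in E -> exists2 y, y \in E & g y = f x.
Hypothesis f_coherent : forall w w' c1 c2, w \in E -> w' \in E -> f w = f w' ->
  fibre_products f c1 c2 w = fibre_products f c1 c2 w'.
Hypothesis fg_iso : forall w w' c1 c2, w \in E -> w' \in E -> f w = g w' ->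
  fibre_products f c1 c2 w = fibre_products g c1 c2 w'.

(** A basis identifies E with the codes and turns f and g into colourings of codes; the linear map
    found there is read back as an endomorphism of E. *)
Lemma colouring_iso_Aut w w' : w \in E -> w' \in E -> f w = g w' ->
  exists2 s, s \in Aut E & s w = w' /\ {in E, forall x, f x = g (s x)}.
Proof.
move=> Ew Ew' e; have [a [b [Ea Eb inj_u]]] := exists_basis9.
pose u := word a b; have Eu k : u k \in E by apply: word_mem.
have inj_u' : {in iota 0 9 &, injective u}.
  by move=> k l; rewrite !mem_iota; apply: inj_u.
have uniq_u : uniq (map u (iota 0 9)) by rewrite map_inj_in_uniq ?iota_uniq.
have imu : map u (iota 0 9) =i E.
  apply/subset_cardP; first by rewrite (card_uniqP uniq_u) size_map size_iota.
  by apply/subsetP=> _ /mapP[k _ ->].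
have uP x : x \in E -> exists2 k, k < 9 & u k = x.
  by rewrite -imu => /mapP[k]; rewrite mem_iota => k9 ->; exists k.
have u0 : u 0 = 1 by rewrite /u /word mulg1.
have u_sub k v : k < 9 -> v < 9 -> u (sub9 v k) = (u k)^-1 * u v.
  by move=> k9 v9; rewrite -{2}(add9_sub9 k9 v9) /u word_add9 ?mulKg.
have countE h c1 c2 v : v < 9 ->
    count_products (h \o u) c1 c2 v = fibre_products h c1 c2 (u v).
  move=> v9; pose P x := (h x == c1) && (h (x^-1 * u v) == c2).
  transitivity (count P (map u (iota 0 9))).
    rewrite count_map; apply: eq_in_count => k; rewrite mem_iota => k9.
    by rewrite /P /= u_sub.
  rewrite -size_filter -(card_uniqP (filter_uniq _ uniq_u)).
  by apply: eq_card => x; rewrite mem_filter imu inE andbC.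
have [k k9 uk] := uP w Ew; have [k' k9' uk'] := uP w' Ew'.
have [||||||x [y [x9 y9 lw lfg]]] :=
    @colouring_iso_linear C (f \o u) (g \o u) _ _ _ _ _ k k' k9 k9'.
- by move=> m m9; rewrite /= u0 => /f1 fm; apply: inj_u => //; rewrite -/u u0 fm.
- by move=> m l _ _ /=; apply: fg.
- move=> m _; have [z Ez gz] := g_onto (Eu m); have [l l9 ul] := uP z Ez.
  by exists l; rewrite //= ul.
- by move=> v v' c1 c2 v9 v9' fv; rewrite !countE //; apply: f_coherent.
- by move=> v v' c1 c2 v9 v9' fv; rewrite !countE //; apply: fg_iso.
- by rewrite /= uk uk'.
pose code z := find (fun k => u k == z) (iota 0 9).
have codeK m : m < 9 -> code (u m) = m.
  move=> m9; have hasm : has (fun k => u k == u m) (iota 0 9).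
    by apply/hasP; exists m; rewrite ?mem_iota.
  have lt9 : code (u m) < 9 by rewrite -[9](size_iota 0) -has_find.
  by apply: inj_u => //; have /eqP := nth_find 0 hasm; rewrite nth_iota.
pose v m := u (lin9 x y m); pose s z := v (code z).
have vM m l : v (add9 m l) = v m * v l.
  by rewrite /v /u !word_lin9 // -/u word_add9.
have sM : {in E &, {morph s : z t / z * t}}.
  move=> z t /uP[m m9 <-] /uP[l l9 <-].
  by rewrite /s /u -word_add9 // -/u !codeK ?add9_lt.
have Es z : s z \in E by apply: Eu.
have fs z : z \in E -> f z = g (s z).
  by case/uP=> m m9 <-; rewrite /s codeK //; apply: lfg.
have s_inj : 'injm (Morphism sM).
  (* A kernel element z has f z = g 1 = f 1, so z = 1 by [f1]. *)
  apply/subsetP=> z /morphpreP[Ez /set1P /= sz]; apply/set1P; apply: f1 => //.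
  by rewrite !fs // sz; congr g; rewrite -u0 /s codeK // /v /u word_lin9 // /word !mulg1.
have s_im : Morphism sM @* E = E.
  apply/eqP; rewrite eqEcard card_injm // leqnn andbT.
  by apply/subsetP=> _ /morphimP[z _ _ ->]; apply: Es.
exists (aut s_inj s_im); first exact: Aut_aut.
split; last by move=> z Ez; rewrite autE //=; apply: fs.
by rewrite autE //= /s -uk codeK // /v lw.
Qed.

End ElementaryAbelian9.

(** * S-rings over E x P *)

Section WreathProducts.

Variables (gT : finGroupType) (G : {group gT}) (A : sring G).
Hypothesis cGG : abelian G.

Lemma stabilizer_group_set (S : {set gT}) : group_set [set g in G | g *: S == S].
Proof.
apply/group_setP; split=> [|g h]; first by rewrite inE group1 lcoset1 eqxx.
rewrite !inE => /andP[Gg /eqP gS] /andP[Gh /eqP hS].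
by rewrite groupM //= lcosetM hS gS eqxx.
Qed.

Definition stabilizer S := Group (stabilizer_group_set S).

Lemma stabilizerP (S : {set gT}) g :
  reflect (g \in G /\ forall x, x \in S -> g * x \in S) (g \in stabilizer S).
Proof.
rewrite inE; apply: (iffP andP) => -[Gg].
  by move/eqP=> gS; split=> // x Sx; rewrite -gS mem_lcoset mulKg.
move=> clS; split=> //; rewrite eqEcard card_lcoset leqnn andbT.
by apply/subsetP=> _ /lcosetP[x Sx ->]; apply: clS.
Qed.

Lemma sring_set_stabilizer S : sring_set A S -> sring_set A (stabilizer S).
Proof. exact: sring_set_stab. Qed.

Lemma stabilizer_sub_basic S x y :
    sring_set A S -> x \in stabilizer S -> y \in basic_set A x ->
  y \in stabilizer S.
Proof. by move/sring_set_stabilizer=> AS; apply: sring_set_closed. Qed.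

(** As G is abelian, left stability gives the radical and |U| <= 3 |L| bounds the section; these are
    the forms in which the wreath conditions arise below. *)
Lemma proper_wreath_intro (U L : {group gT}) :
    sring_set A U -> sring_set A L -> L \subset U -> L :!=: 1 -> U :!=: G ->
    #|U| <= 3 * #|L| ->
    (forall x, x \in G -> x \notin U -> L \subset stabilizer (basic_set A x)) ->
  exists U L : {group gT}, is_proper_wreath_product A U L /\ #|U / L| <= 3.
Proof.
move=> AU AL sLU ntL nUG leUL stabL.
have sUG := sring_setS AU; have sLG := subset_trans sLU sUG.
have nLG : G \subset 'N(L) := sub_abelian_norm cGG sLG.
exists U, L; split; last first.
  by rewrite card_quotient ?(subset_trans sUG) // -divgS // leq_divLR ?cardSg.
split=> //; split.
- split; [|exact: sring_subgroupP AU|exact: sring_subgroupP AL].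
  by rewrite /normal sLU (subset_trans sUG).
- by rewrite /normal sLG.
move=> X bX /subsetPn[x Xx nUx].
have Gx : x \in G.
  by rewrite -(cover_basic A); apply/bigcupP; exists X.
rewrite -(basic_set_def bX Xx).
apply/subsetP=> l Ll; have := subsetP (stabL x Gx nUx) l Ll.
rewrite !inE => /andP[Gl /eqP lX]; rewrite Gl lX eqxx /=.
rewrite -[X in _ == X]lX eqEcard card_rcoset card_lcoset leqnn andbT.
apply/subsetP=> _ /rcosetP[y xy ->]; rewrite mem_lcoset.
have Gy := subsetP (basic_set_sub A x) y xy.
by rewrite -(centsP cGG l Gl) // ?groupM // mulKg.
Qed.

End WreathProducts.

Lemma card3_cases (gT : finGroupType) (H : {group gT}) x y :
  #|H| = 3 -> x \in H -> x != 1 -> y \in H -> [\/ y = 1, y = x | y = x^-1].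
Proof.
move=> cardH Hx ntx Hy.
have ox : #[x] = 3 by apply: nt_prime_order ntx => //; rewrite -cardH expg_cardG.
have HE : <[x]> = H by apply/eqP; rewrite eqEcard cycle_subG Hx cardH -orderE ox /=.
move: Hy; rewrite -HE => /cycleP[i ->]; rewrite -expg_mod_order ox.
have : i %% 3 < 3 by rewrite ltn_mod.
case: (i %% 3) => [|[|[|//]]] _; [exact: Or31 | exact: Or32 |].
by apply: Or33; apply: (mulgI x); rewrite -expgS -ox expg_order mulgV.
Qed.

(** * Coordinates, multipliers and prime roots in E x P *)

Section Setup.

Variables (p : nat) (gT : finGroupType) (G E P : {group gT}) (A : sring G).
Hypotheses (p_pr : prime p) (p_gt3 : 3 < p).
Hypotheses (cGG : abelian G) (defG : E \x P = G).
Hypotheses (cardE9 : #|E| = 9) (cardP : #|P| = p).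
Hypothesis expE : forall x, x \in E -> x ^+ 3 = 1.

Local Notation cl := (basic_set A).

Lemma subEG : E \subset G. Proof. by case/dprodP: defG => _ <- _ _; apply: mulG_subl. Qed.
Lemma subPG : P \subset G. Proof. by case/dprodP: defG => _ <- _ _; apply: mulG_subr. Qed.
Let sEG := subsetP subEG.
Let sPG := subsetP subPG.

Lemma mulEP_eq u z v t : u \in E -> z \in P -> v \in E -> t \in P ->
  u * z = v * t -> u = v /\ z = t.
Proof.
move=> Eu Pz Ev Pt e; have [_ _ _ tiEP] := dprodP defG.
have e' : v^-1 * u = t * z^-1.
  by apply: (mulIg z); rewrite mulgKV -mulgA e mulKg.
have : v^-1 * u \in E :&: P by rewrite inE {2}e' !groupM ?groupV.
rewrite tiEP => /set1P e1; move: (e1); rewrite e' => /eqP.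
rewrite -eq_mulgV1 => /eqP->; split=> //.
by apply/esym/eqP; rewrite eq_mulVg1 e1.
Qed.

Lemma mulEP_mem u z : u \in E -> z \in P -> u * z \in G.
Proof. by move=> Eu Pz; rewrite groupM ?(sEG Eu) ?(sPG Pz). Qed.

Lemma commuteEP u z : u \in E -> z \in P -> commute u z.
Proof. by move=> Eu Pz; apply: (centsP cGG); [apply: sEG | apply: sPG]. Qed.

Lemma mulEPP x : x \in G -> exists u z, [/\ u \in E, z \in P & x = u * z].
Proof.
have [_ <- _ _] := dprodP defG.
by case/mulsgP=> u z Eu Pz ->; exists u, z.
Qed.

Lemma p_coprime3 : coprime 3 p.
Proof. by rewrite coprime_sym prime_coprime // gtnNdvd. Qed.

Lemma expP z : z \in P -> z ^+ p = 1.
Proof. by move=> Pz; rewrite -cardP expg_cardG. Qed.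

Lemma expg_mulEP u z n m1 m2 : u \in E -> z \in P ->
  n = m1 %[mod 3] -> n = m2 %[mod p] -> (u * z) ^+ n = u ^+ m1 * z ^+ m2.
Proof.
move=> Eu Pz e1 e2; have cuz := commuteEP Eu Pz.
rewrite expgMn //; congr (_ * _).
  by rewrite -(expg_mod n (expE Eu)) e1 expg_mod ?expE.
by rewrite -(expg_mod n (expP Pz)) e2 expg_mod ?expP.
Qed.

Lemma coprimeG_chinese k1 k2 : coprime 3 k1 -> coprime p k2 ->
  coprime #|G| (chinese 3 p k1 k2).
Proof.
move=> co1 co2; set k := chinese 3 p k1 k2.
have co3 : coprime 3 k by rewrite -coprime_modr chinese_modl ?p_coprime3 // coprime_modr.
have cop : coprime p k by rewrite -coprime_modr chinese_modr ?p_coprime3 // coprime_modr.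
by rewrite -(dprod_card defG) cardE9 cardP coprimeMl cop -[9]/(3 ^ 2)%N coprimeXl.
Qed.

(** An exponent that is 1 modulo 3 and k modulo p acts on the P-component only. *)
Lemma twistP u z v t k : u \in E -> z \in P -> v \in E -> t \in P -> coprime p k ->
  v * t \in cl (u * z) -> v * t ^+ k \in cl (u * z ^+ k).
Proof.
move=> Eu Pz Ev Pt co_k uv.
have co := coprimeG_chinese (coprimen1 3) co_k.
have := basic_set_expg cGG co (mulEP_mem Eu Pz) uv.
by rewrite !(@expg_mulEP _ _ _ 1 k) ?chinese_modl ?chinese_modr ?p_coprime3.
Qed.

Lemma invgE_exp u : u \in E -> u ^+ 2 = u^-1.
Proof. by move=> Eu; apply: (mulgI u); rewrite -expgS expE // mulgV. Qed.

(** An exponent that is 2 modulo 3 and 1 modulo p inverts the E-component only. *)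
Lemma flipE u z v t : u \in E -> z \in P -> v \in E -> t \in P ->
  v * t \in cl (u * z) -> v^-1 * t \in cl (u^-1 * z).
Proof.
move=> Eu Pz Ev Pt uv.
have co := coprimeG_chinese (erefl : coprime 3 2) (coprimen1 p).
have := basic_set_expg cGG co (mulEP_mem Eu Pz) uv.
by rewrite !(@expg_mulEP _ _ _ 2 1) ?chinese_modl ?chinese_modr ?p_coprime3 // !invgE_exp.
Qed.

Lemma generatorP z t : z \in P -> z != 1 -> t \in P -> t != 1 ->
  exists2 k, coprime p k & t = z ^+ k.
Proof.
move=> Pz ntz Pt ntt.
have PZ : P :=: <[z]>.
  apply/esym/eqP; rewrite eqEcard cycle_subG Pz /= cardP -orderE.
  by rewrite (nt_prime_order p_pr (expP Pz) ntz).
have /cycleP[k tk] : t \in <[z]> by rewrite -PZ.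
exists k; rewrite // prime_coprime //; apply: contraNN ntt => /dvdnP[m km].
by rewrite tk km mulnC expgM expP // expg1n.
Qed.

Lemma exists_generatorP : exists2 z, z \in P & z != 1.
Proof.
have : P :!=: 1 by rewrite -cardG_gt1 cardP (leq_trans _ p_gt3).
by case/trivgPn=> z; exists z.
Qed.

Lemma expg_p_inj u v : u \in E -> v \in E -> u ^+ p = v ^+ p -> u = v.
Proof.
move=> Eu Ev e; have co : coprime #|E| p.
  by rewrite cardE9 -[9]/(3 ^ 2)%N coprimeXl // p_coprime3.
by rewrite -(expgK co Eu) /= e expgK.
Qed.

Lemma expg_3_inj z t : z \in P -> t \in P -> z ^+ 3 = t ^+ 3 -> z = t.
Proof.
move=> Pz Pt e; have co : coprime #|P| 3 by rewrite cardP coprime_sym p_coprime3.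
by rewrite -(expgK co Pz) /= e expgK.
Qed.

(** The case q = p of the Frobenius argument: p-th powers kill P and are injective on E, so the
    fibre over u^p is S ∩ uP. *)
Lemma sring_set_root_p S : sring_set A S ->
  sring_set A [set u ^+ p | u in [set u in E | ~~ (p %| #|S :&: u *: P|)]].
Proof.
move=> AS; have sSG := subsetP (sring_setS AS).
rewrite (_ : [set _ | _ in _]
           = [set x in G | ~~ (p %| #|[set s in S | s ^+ p == x]|)]).
  exact: sring_set_expg_prime.
have cosetE u : u \in E -> [set s in S | s ^+ p == u ^+ p] = S :&: u *: P.
  move=> Eu; apply/setP=> s; rewrite !inE; case Ss: (s \in S) => //=.
  have [v [t [Ev Pt ->]]] := mulEPP (sSG s Ss); rewrite mem_lcoset.
  rewrite expgMn ?(expP Pt) ?mulg1; last exact: commuteEP.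
  apply/eqP/idP => [/(expg_p_inj Ev Eu)-> | ]; first by rewrite mulKg.
  move=> Pw; have [|<- //] := @mulEP_eq u (u^-1 * (v * t)) v t Eu Pw Ev Pt.
  by rewrite mulKVg.
apply/setP=> x; rewrite inE; apply/imsetP/andP => [[u] | [Gx]].
  rewrite inE => /andP[Eu nu] ->; rewrite groupX ?sEG // cosetE //.
case: (set_0Vmem [set s in S | s ^+ p == x]) => [->|[s]]; first by rewrite cards0 dvdn0.
rewrite inE => /andP[Ss /eqP <-{x Gx}].
have [v [t [Ev Pt ->]]] := mulEPP (sSG s Ss).
have -> : (v * t) ^+ p = v ^+ p.
  by rewrite expgMn ?(expP Pt) ?mulg1 //; apply: commuteEP.
by rewrite cosetE // => nv; exists v; rewrite // inE Ev.
Qed.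

(** The case q = 3: cubes kill E and are injective on P, so the fibre over z^3 is S ∩ zE. *)
Lemma sring_set_root_3 S : sring_set A S ->
  sring_set A [set z ^+ 3 | z in [set z in P | ~~ (3 %| #|S :&: z *: E|)]].
Proof.
move=> AS; have sSG := subsetP (sring_setS AS).
rewrite (_ : [set _ | _ in _]
           = [set x in G | ~~ (3 %| #|[set s in S | s ^+ 3 == x]|)]).
  exact: sring_set_expg_prime.
have cubeE v t : v \in E -> t \in P -> (v * t) ^+ 3 = t ^+ 3.
  by move=> Ev Pt; rewrite expgMn ?(expE Ev) ?mul1g //; apply: commuteEP.
have cosetE z : z \in P -> [set s in S | s ^+ 3 == z ^+ 3] = S :&: z *: E.
  move=> Pz; apply/setP=> s; rewrite !inE; case Ss: (s \in S) => //=.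
  have [v [t [Ev Pt ->]]] := mulEPP (sSG s Ss); rewrite mem_lcoset cubeE //.
  have cvt : v * t = t * v := commuteEP Ev Pt.
  apply/eqP/idP => [/(expg_3_inj Pt Pz)<- | Ew]; first by rewrite cvt mulKg.
  have [|_ -> //] := mulEP_eq Ew Pz Ev Pt.
  by rewrite (commuteEP Ew Pz) mulKVg.
apply/setP=> x; rewrite inE; apply/imsetP/andP => [[u] | [Gx]].
  by rewrite inE => /andP[Pu nu] ->; rewrite groupX ?sPG // cosetE.
case: (set_0Vmem [set s in S | s ^+ 3 == x]) => [->|[s]]; first by rewrite cards0 dvdn0.
rewrite inE => /andP[Ss /eqP <-{x Gx}].
have [v [t [Ev Pt ->]]] := mulEPP (sSG s Ss).
by rewrite cubeE // cosetE // => nv; exists t; rewrite // inE Pt.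
Qed.


(** The largest A-subgroup inside E; that it is a group is [gen_coreE], because the subgroup it
    generates is again an A-set inside E. *)
Definition coreE := [set g in E | cl g \subset E].

Lemma sring_set_coreE : sring_set A coreE.
Proof.
apply/sring_setP; split=> [|x y]; first by apply/subsetP=> x; rewrite inE => /andP[/sEG].
rewrite !inE => /andP[Ex xE] xy.
by rewrite (basic_set_eq xy) xE (subsetP xE).
Qed.

Lemma coreE_max S : sring_set A S -> S \subset E -> S \subset coreE.
Proof.
move=> AS sSE; apply/subsetP=> x Sx; rewrite inE (subsetP sSE) //=.
exact: subset_trans (sring_set_sub AS Sx) sSE.
Qed.

Lemma coreE_sub : coreE \subset E.
Proof. by apply/subsetP=> x; rewrite inE => /andP[]. Qed.

Lemma gen_coreE : <<coreE>> = coreE.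
Proof.
apply/eqP; rewrite eqEsubset subset_gen andbT coreE_max //.
  exact/sring_set_gen/sring_set_coreE.
by rewrite gen_subG coreE_sub.
Qed.

(* For h outside the largest A-subgroup of E, the p-th power of a basic set   *)
(* X modulo p leaves no room for |X :&: hP| strictly between 0 and p.         *)
Lemma coset_sub_basic h z x : h \in E -> h \notin coreE -> z \in P ->
  h * z \in cl x -> forall t, t \in P -> h * t \in cl x.
Proof.
move=> Eh nh Pz xhz t Pt; have AX := sring_set_basic A x.
have AT := sring_set_root_p AX; set T := [set _ | _ in _] in AT.
have sTE : T \subset E.
  by apply/subsetP=> _ /imsetP[u + ->]; rewrite inE => /andP[Eu _]; apply: groupX.
have p_dv : p %| #|cl x :&: h *: P|.
  apply: contraNT nh => nd.
  have Chp : h ^+ p \in <<coreE>>.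
    apply: mem_gen; apply: (subsetP (coreE_max AT sTE)).
    by apply: imset_f; rewrite inE Eh.
  have co : coprime #|E| p by rewrite cardE9 -[9]/(3 ^ 2)%N coprimeXl // p_coprime3.
  by rewrite -gen_coreE -(expgK co Eh) /= groupX.
have sub : h *: P \subset cl x.
  apply/setIidPr/eqP; rewrite eqEcard subsetIr card_lcoset cardP dvdn_leq //.
  by rewrite card_gt0; apply/set0Pn; exists (h * z); rewrite inE xhz mem_lcoset mulKg.
by apply: (subsetP sub); rewrite mem_lcoset mulKg.
Qed.

(** A multiplier of P maps hz to another point of hP, and hP lies in the basic set; hence it maps
    this basic set to itself. *)
Lemma basic_set_stable h z x u t t' : h \in E -> h \notin coreE -> z \in P ->
    h * z \in cl x -> u \in E -> t \in P -> t != 1 -> t' \in P -> t' != 1 ->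
  u * t \in cl x -> u * t' \in cl x.
Proof.
move=> Eh nh Pz xhz Eu Pt ntt Pt' ntt' xut.
have [k co_k ->] := generatorP Pt ntt Pt' ntt'.
have clx := basic_set_eq xhz.
have := twistP Eh Pz Eu Pt co_k; rewrite clx => /(_ xut).
by rewrite (basic_set_eq (coset_sub_basic Eh nh Pz xhz (groupX k Pz))).
Qed.

Lemma mulE_cycle (L : {group gT}) y : L \subset E -> #|L| = 3 ->
  y \in E -> y \notin L -> #[y] = 3 /\ <[y]> * L = E.
Proof.
move=> sLE cardL Ey nLy.
have oy : #[y] = 3.
  by apply: nt_prime_order; rewrite ?expE //; apply: contraNneq nLy => ->; apply: group1.
split=> //; have tiy : <[y]> :&: L = 1.
  by apply: prime_TIg; rewrite -?orderE ?oy // cycle_subG.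
have sE : <[y]> * L \subset E by rewrite mul_subG // cycle_subG.
by apply/eqP; rewrite eqEcard sE cardE9 TI_cardMg // -orderE oy cardL.
Qed.

(** * E is not an A-subgroup *)

Section ProperCore.

Variables (E1 : {group gT}) (h : gT).
Hypotheses (defE1 : E1 = coreE :> {set gT}) (Eh : h \in E) (nE1h : h \notin E1).

Let AE1 : sring_set A E1. Proof. by rewrite defE1 sring_set_coreE. Qed.
Let sE1E : E1 \subset E. Proof. by rewrite defE1 coreE_sub. Qed.
Let EE1 u : u \in E1 -> u \in E. Proof. exact: (subsetP sE1E). Qed.
Let E1_coreE u : u \notin E1 -> u \notin coreE. Proof. by rewrite defE1. Qed.
Let E1_basic u x : u \in E1 -> x \in cl u -> x \in E1.
Proof. exact: sring_set_closed AE1. Qed.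

Lemma card_coreE_le3 : #|E1| <= 3.
Proof.
have: #|E1| %| 3 ^ 2 by rewrite -[(3 ^ 2)%N]cardE9 cardSg.
case/(dvdn_pfactor _ _ (erefl : prime 3)) => [[|[|[|//]]]] _ e; rewrite e //.
case/negP: nE1h; suff -> : E1 :=: E by [].
by apply/eqP; rewrite eqEcard sE1E cardE9 e.
Qed.

Lemma core_mul_group : E1 <*> P = E1 * P.
Proof.
apply: cent_joinEr; apply: (sub_abelian_cent2 cGG); first exact: subPG.
exact: subset_trans sE1E subEG.
Qed.

Lemma coset_stable x v t t' : v \in E -> v \notin E1 -> t \in P -> t' \in P ->
  v * t \in cl x -> v * t' \in cl x.
Proof. by move=> Ev /E1_coreE nv Pt Pt' /(coset_sub_basic Ev nv Pt); apply. Qed.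

(** Take U = E1 P and L generated by the basic sets meeting P. Then P <= L <= U, so the index is at
    most |E1| <= 3. A basic set outside U is a union of P-cosets; its stabilizer is an A-subgroup
    containing P, hence L. *)
Lemma wreath_core_mul : sring_set A (E1 * P) ->
  exists U L : {group gT}, is_proper_wreath_product A U L /\ #|U / L| <= 3.
Proof.
move=> AEP.
pose S := \bigcup_(z in P) cl z.
have AS : sring_set A S.
  apply/sring_setP; split; first by apply/bigcupsP => z _; apply: basic_set_sub.
  by move=> x y /bigcupP[z Pz zx] xy; apply/bigcupP; exists z; rewrite // -(basic_set_eq zx).
have sPS : P \subset <<S>>.
  apply: subset_trans (subset_gen S); apply/subsetP=> z Pz.
  by apply/bigcupP; exists z; rewrite ?mem_basic_set ?sPG.
apply: (@proper_wreath_intro _ _ _ cGG (E1 <*> P) <<S>>).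
- by rewrite /= core_mul_group.
- exact: sring_set_gen.
- rewrite gen_subG /= core_mul_group; apply/bigcupsP=> z Pz.
  by apply: sring_set_sub => //; rewrite -[z]mul1g mem_mulg.
- by rewrite /= -cardG_gt1 (leq_trans _ (subset_leq_card sPS)) // cardP prime_gt1.
- apply: contraNneq nE1h => defU.
  have: h \in E1 <*> P by rewrite defU sEG.
  rewrite core_mul_group => /mulsgP[u z E1u Pz e].
  have [|-> _] := mulEP_eq Eh (group1 P) (EE1 E1u) Pz; last by [].
  by rewrite mulg1.
- rewrite /= core_mul_group (@leq_trans (#|E1| * #|P|)) //.
    by rewrite mul_cardG leq_pmulr ?cardG_gt0.
  by rewrite leq_mul ?card_coreE_le3 ?subset_leq_card.
move=> x Gx nEPx; rewrite gen_subG; apply/bigcupsP => z Pz; apply/subsetP=> y zy.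
apply: stabilizer_sub_basic zy; first exact: sring_set_basic.
apply/stabilizerP; split; first exact: sPG.
move=> y' xy'; have Gy' := subsetP (basic_set_sub A x) _ xy'.
have nEPy' : y' \notin E1 * P by rewrite (mem_sring_set AEP Gx xy') -core_mul_group.
have [v [t [Ev Pt ey']]] := mulEPP Gy'; rewrite ey' in xy' nEPy' *.
have nE1v : v \notin E1 by apply: contraNN nEPy' => E1v; rewrite mem_mulg.
rewrite mulgA -(commuteEP Ev Pz) -mulgA; apply: coset_stable xy' => //.
exact: groupM.
Qed.


(** A basic set that meets E1 P and leaves it contains some vt with v outside E1, hence the whole of
    vP and in particular v. *)
Lemma sring_set_core_mul_or : sring_set A (E1 * P) \/
  exists u z v, [/\ u \in E1, z \in P & z != 1] /\
                [/\ v \in E, v \notin E1 & v \in cl (u * z)].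
Proof.
have [|nA] := boolP (sring_set A (E1 * P)); [by left | right].
have sEPG : E1 * P \subset G.
  by rewrite -core_mul_group join_subG (subset_trans sE1E subEG) subPG.
move: nA; rewrite /sring_set sEPG /= => /forall_inPn[x].
case/mulsgP=> u z E1u Pz -> /subsetPn[y uzy nEPy].
have [v [t [Ev Pt ey]]] := mulEPP (subsetP (basic_set_sub A (u * z)) _ uzy).
have nE1v : v \notin E1 by apply: contraNN nEPy => E1v; rewrite ey mem_mulg.
exists u, z, v; split; split=> //.
  apply: contraNneq nE1v => z1.
  suff: v * t \in E1.
    move=> E1vt; have [|e _] := mulEP_eq Ev Pt (EE1 E1vt) (group1 P).
      by rewrite mulg1.
    by rewrite e.
  by apply: (@E1_basic (u * z)); rewrite -?ey // z1 mulg1.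
by rewrite -[v]mulg1 (coset_stable Ev nE1v Pt) // -ey.
Qed.

(** * A basic set meeting both E1 P and E outside E1 *)

Section MixedBasicSet.

Variables (u z v : gT).
Hypotheses (E1u : u \in E1) (Pz : z \in P) (ntz : z != 1).
Hypotheses (Ev : v \in E) (nE1v : v \notin E1) (uzv : v \in cl (u * z)).

Let X := cl (u * z).
Let D := X * E1 :|: E1.
Let Eu : u \in E := EE1 E1u.
Let Guz : u * z \in G := mulEP_mem Eu Pz.

Let X_stable w t t' : w \in E -> t \in P -> t != 1 -> t' \in P -> t' != 1 ->
  w * t \in X -> w * t' \in X.
Proof.
by move=> *; apply: (@basic_set_stable v 1 (u * z) w t t');
  rewrite ?mulg1 ?group1 // E1_coreE.
Qed.

Let AD : sring_set A D.
Proof. by rewrite sring_setU ?sring_setM ?sring_set_basic. Qed.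

(** Points of X with E-component outside E1 come in full P-cosets. Those with component in E1 are
    handled by D containing all of E1 P: the multipliers of P and translation by E1 produce every w
    t with t nontrivial, and E1 itself is added in D. *)
Let P_stab_D t : t \in P -> t \in stabilizer G D.
Proof.
move=> Pt; apply/stabilizerP; split; first exact: sPG.
have D_E1 w t' : w \in E1 -> t' \in P -> w * t' \in D.
  move=> E1w Pt'; have [->|ntt'] := eqVneq t' 1; first by rewrite mulg1 inE E1w orbT.
  apply/setUP; left; rewrite -[w * t'](_ : (u * t') * (u^-1 * w) = _).
    apply: mem_mulg; last by rewrite groupM ?groupV.
    by apply: (X_stable Eu Pz) => //; apply: mem_basic_set.
  have Euw : u^-1 * w \in E by rewrite groupM ?groupV ?EE1.
  by rewrite -mulgA -(commuteEP Euw Pt') !mulgA mulgV mul1g.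
move=> x /setUP[/mulsgP[y w Xy E1w ->] | E1x]; last first.
  by rewrite -(commuteEP (EE1 E1x) Pt) D_E1.
have [w' [t' [Ew' Pt' ey]]] := mulEPP (subsetP (basic_set_sub A _) y Xy).
rewrite mulgA {1}ey mulgA -(commuteEP Ew' Pt) -(mulgA w') .
have [E1w' | nE1w'] := boolP (w' \in E1).
  rewrite -mulgA -(commuteEP (EE1 E1w)) ?groupM // mulgA D_E1 ?groupM //.
rewrite inE mem_mulg //; apply: (coset_stable Ew' nE1w' Pt'); rewrite -?ey //.
exact: groupM.
Qed.

Let E1_stab_D w : w \in E1 -> w \in stabilizer G D.
Proof.
move=> E1w; apply/stabilizerP; split; first exact/sEG/EE1.
move=> x Dx; have Gx := subsetP (sring_setS AD) x Dx.
rewrite (centsP cGG w (sEG (EE1 E1w)) x Gx).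
case/setUP: Dx => [/mulsgP[y w' Xy E1w' ->] | E1x]; last by rewrite inE groupM ?orbT.
by rewrite -mulgA; apply/setUP; left; rewrite mem_mulg ?groupM.
Qed.

(** The stabilizer of D is an A-set containing u and z, hence u z, hence the whole basic set X. *)
Let X_stab_D x : x \in X -> x \in stabilizer G D.
Proof.
move=> Xx; apply: (stabilizer_sub_basic AD _ Xx).
by apply: groupM; [apply: E1_stab_D | apply: P_stab_D].
Qed.

Lemma stabilizer_mixed : stabilizer G D = D :> {set gT}.
Proof.
apply/eqP; rewrite eqEsubset; apply/andP; split; apply/subsetP=> x.
  by case/stabilizerP=> _ /(_ 1); rewrite mulg1; apply; rewrite inE group1 orbT.
case/setUP=> [/mulsgP[y w Xy E1w ->]|]; last exact: E1_stab_D.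
by apply: groupM; [apply: X_stab_D | apply: E1_stab_D].
Qed.

(** Here D = 1 ∪ X is a group. If it is not G, basic sets outside D are unions of P-cosets, so their
    stabilizers contain z and with it X; this gives the wreath product with U = L = D. *)
Lemma mixed_core1 : #|E1| = 1%N ->
  trivial_sring A \/
  exists U L : {group gT}, is_proper_wreath_product A U L /\ #|U / L| <= 3.
Proof.
move/eqP; rewrite -trivg_card1 => /eqP E1_1.
have DE : D = 1 |: X by rewrite /D E1_1 mulg1 setUC.
have R1X : stabilizer G D = 1 |: X :> {set gT} by rewrite stabilizer_mixed DE.
have u1 : u = 1 by apply/set1P; have := E1u; rewrite E1_1.
have [RG | nRG] := eqVneq (stabilizer G D :> {set gT}) G.
  left; rewrite /trivial_sring /sring_rank (_ : basic_sets A = [set 1%g; X]).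
    rewrite cards2; suff -> : 1%g != X by [].
    apply: contraNneq nE1v => X1; rewrite E1_1.
    by move: uzv; rewrite -/X -X1.
  apply/setP=> Y; rewrite !inE; apply/idP/orP => [/basic_setsP[y Gy ->] | ].
    move: Gy; rewrite -RG R1X => /setU1P[->|Xy]; first by rewrite basic_set1 eqxx; left.
    by right; rewrite (basic_set_eq Xy).
  by case=> /eqP ->; [apply: basic_1 | apply: basic_setP].
right; have AR : sring_set A (stabilizer G D) by apply: sring_set_stabilizer.
apply: (@proper_wreath_intro _ _ _ cGG (stabilizer G D) (stabilizer G D)) => //.
- apply/trivgPn; exists z; rewrite ?P_stab_D //.
- by rewrite leq_pmull.
move=> x Gx nRx; have sPstab t : t \in P -> t \in stabilizer G (cl x).
  move=> Pt; apply/stabilizerP; split; first exact: sPG.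
  move=> y xy; have [w [t' [Ew Pt' ey]]] := mulEPP (subsetP (basic_set_sub A x) y xy).
  have nRy : y \notin stabilizer G D by rewrite (mem_sring_set AR Gx xy).
  have nE1w : w \notin E1.
    apply: contraNN nRy; rewrite E1_1 => /set1P w1.
    by rewrite ey w1 mul1g P_stab_D.
  rewrite ey mulgA -(commuteEP Ew Pt) -mulgA.
  by apply: (coset_stable Ew nE1w Pt'); rewrite ?groupM // -ey.
apply/subsetP=> y; rewrite -/(stabilizer G D) R1X => /setU1P[-> | Xy]; first exact: group1.
apply: stabilizer_sub_basic Xy; first exact: sring_set_basic.
by rewrite u1 mul1g sPstab.
Qed.

(** The group D contains E1 and v, so it meets E in more than 3 elements and therefore contains E;
    it also contains P. *)
Lemma mixed_core3 : #|E1| = 3 -> forall x, x \in G -> x \in D.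
Proof.
move=> cardE1 x Gx; rewrite -stabilizer_mixed.
have sEstab : E \subset stabilizer G D.
  have: #|stabilizer G D :&: E| %| 3 ^ 2 by rewrite -[(3 ^ 2)%N]cardE9 cardSg ?subsetIr.
  have lt3 : 3 < #|stabilizer G D :&: E|.
    rewrite -cardE1 proper_card //; apply/properP; split.
      by rewrite subsetI sE1E andbT; apply/subsetP=> w; apply: E1_stab_D.
    by exists v; rewrite // inE Ev X_stab_D.
  case/(dvdn_pfactor _ _ (erefl : prime 3)) => [[|[|[|//]]]] _ e; rewrite e // in lt3.
  apply/setIidPr/eqP; rewrite eqEcard subsetIr cardE9.
  by move: e => /= ->.
have [w [t [Ew Pt ->]]] := mulEPP Gx.
by apply: groupM; [apply: (subsetP sEstab) | apply: P_stab_D].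
Qed.

End MixedBasicSet.


(** * The case |E1| = 3: equidistribution over the cosets of E1 *)

Section Core3.

Hypothesis cardE1 : #|E1| = 3.
Variable x0 : gT.
Hypothesis cover_x0 : forall x, x \in G -> x \notin E1 -> x \in cl x0 * E1.

Let clG x y : y \in cl x -> y \in G.
Proof. exact: (subsetP (basic_set_sub A x)). Qed.

Let Gh : h \in G := sEG Eh.

Let nE1_cl x y : x \in G -> x \notin E1 -> y \in cl x -> y \notin E1.
Proof. by move=> Gx nx xy; rewrite (mem_sring_set AE1 Gx xy). Qed.

Lemma cover_outside y x : y \in G -> y \notin E1 -> x \in G -> x \notin E1 ->
  x \in cl y * E1.
Proof.
move=> Gy nE1y Gx nE1x; have AyE1 := sring_setM (sring_set_basic A y) AE1.
have /mulsgP[y1 e1 x0y1 E1e1 ey] := cover_x0 Gy nE1y.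
have /mulsgP[y2 e2 x0y2 E1e2 ->] := cover_x0 Gx nE1x.
suff y2y : y2 \in cl y * E1.
  by case/mulsgP: y2y => y3 e3 yy3 E1e3 ->; rewrite -mulgA mem_mulg ?groupM.
have y1y : y1 \in cl y * E1.
  by rewrite -(mulgK e1 y1) -ey mem_mulg ?groupV ?mem_basic_set.
apply: sring_set_closed AyE1 y1y _.
by rewrite (basic_set_eq x0y1).
Qed.

(** Both cosets have representatives in the basic set of y, where the intersection number with
    E1-cosets is constant. *)
Lemma card_coset_outside y x x' : y \in G -> y \notin E1 ->
    x \in G -> x \notin E1 -> x' \in G -> x' \notin E1 ->
  #|cl y :&: x *: E1| = #|cl y :&: x' *: E1|.
Proof.
move=> Gy ny Gx nx Gx' nx'.
have /mulsgP[y1 e1 yy1 E1e1 ->] := cover_outside Gy ny Gx nx.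
have /mulsgP[y2 e2 yy2 E1e2 ->] := cover_outside Gy ny Gx' nx'.
rewrite !lcosetM (lcoset_id E1e1) (lcoset_id E1e2).
have Gy1 := clG yy1.
apply: (card_lcoset_basic (sring_set_basic A y) AE1 (clG yy2)).
by rewrite (basic_set_eq yy2).
Qed.

(** Every basic set outside E1 meets h E1, which lies in E outside E1, so [basic_set_stable] applies
    to it. *)
Lemma stable_outside y v t t' : y \in G -> y \notin E1 ->
    v \in E -> t \in P -> t != 1 -> t' \in P -> t' != 1 ->
  v * t \in cl y -> v * t' \in cl y.
Proof.
move=> Gy ny Ev Pt ntt Pt' ntt'.
have /mulsgP[y1 e1 yy1 E1e1 eh] := cover_outside Gy ny Gh nE1h.
have ny1 := nE1_cl Gy ny yy1.
have Ey1 : y1 \in E by rewrite -(mulgK e1 y1) -eh groupM // groupV EE1.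
apply: (basic_set_stable Ey1 (E1_coreE ny1) (group1 P)) => //.
by rewrite mulg1.
Qed.

Let E1_P z : z \in P -> z != 1 -> z \notin E1.
Proof.
move=> Pz; apply: contraNN => E1z; apply/eqP.
have [|//] := @mulEP_eq z 1 1 z (EE1 E1z) (group1 P) (group1 E) Pz.
by rewrite mulg1 mul1g.
Qed.

Lemma core3_wreath_or_tensor :
  (exists U L : {group gT}, is_proper_wreath_product A U L /\ #|U / L| <= 3) \/
  exists (U : {group gT}), [/\ sring_set A U, U \x E1 = G, P \subset U &
    forall x, x \in U -> x != 1 -> cl x = U :\ 1].
Proof.
have [z Pz ntz] := exists_generatorP; have nE1z := E1_P Pz ntz.
have Gz := sPG Pz.
have z_sym e : e \in E -> e * z \in cl z -> e^-1 * z \in cl z.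
  by move=> Ee; have := flipE (group1 E) Pz Ee Pz; rewrite invg1 mul1g.
have [/existsP[e /and3P[E1e nte ze]] | z_only] :=
  boolP [exists e, [&& e \in E1, e != 1 & e * z \in cl z]].
  left; have sE1z : z *: E1 \subset cl z.
    apply/subsetP=> _ /lcosetP[w E1w ->].
    rewrite -(commuteEP (EE1 E1w) Pz).
    have [->|->|->] := card3_cases cardE1 E1e nte E1w => //.
    - by rewrite mul1g mem_basic_set.
    - exact: z_sym (EE1 E1e) ze.
  (* The basic set of z fills z E1, hence by equidistribution every coset of E1 outside E1. So G
     minus E1 is one basic set. *)
  have cl_out x : x \in G -> x \notin E1 -> x \in cl z.
    move=> Gx nx; have sub : x *: E1 \subset cl z.
      apply/setIidPr/eqP; rewrite eqEcard subsetIr card_lcoset.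
      rewrite (card_coset_outside Gz nE1z Gx nx Gz nE1z) (setIidPr sE1z).
      by rewrite card_lcoset leqnn.
    by apply: (subsetP sub); rewrite mem_lcoset mulVg group1.
  apply: (@proper_wreath_intro _ _ _ cGG E1 E1) => //.
  - by rewrite -cardG_gt1 cardE1.
  - by apply: contraNneq nE1h => ->.
  - by rewrite leq_pmull.
  move=> x Gx nx; apply/subsetP=> e' E1e'; apply/stabilizerP; split; first exact/sEG/EE1.
  rewrite (basic_set_eq (cl_out x Gx nx)) => y zy.
  apply: cl_out; first by rewrite groupM ?(clG zy) // sEG ?EE1.
  by rewrite groupMl // (nE1_cl Gz nE1z zy).
(* Now z is the only point of its basic set in z E1, so there is exactly one such point in each
   coset outside E1. The one in h E1 is y, and it lies in E. *)
right; have /mulsgP[y e zy E1e eh] := cover_outside Gz nE1z Gh nE1h.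
have ny := nE1_cl Gz nE1z zy.
have Ey : y \in E by rewrite -(mulgK e y) -eh groupM // groupV EE1.
have [oy yE1E] := mulE_cycle sE1E cardE1 Ey ny.
have nty : y != 1 by apply: contraNneq ny => ->; apply: group1.
(* Nontrivial elements of P are reached by multipliers. The cosets y P and y^-1 P are reached
   because y and, by [flipE], its inverse lie in the basic set of z. *)
have zU w t : w \in <[y]> -> t \in P -> w * t != 1 -> w * t \in cl z.
  move=> yw Pt; have [->|->|->] := card3_cases oy (cycle_id y) nty yw.
  - rewrite mul1g => ntt; have := stable_outside Gz nE1z (group1 E) Pz ntz Pt ntt.
    by rewrite !mul1g mem_basic_set //; apply.
  - by move=> _; apply: (coset_stable Ey ny (group1 P) Pt); rewrite mulg1.
  move=> _; apply: (coset_stable _ _ (group1 P) Pt); rewrite ?groupV //.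
  have := flipE (group1 E) Pz Ey (group1 P); rewrite invg1 !mulg1 mul1g; exact.
have card1 : #|cl z :&: z *: E1| = 1%N.
  rewrite (_ : _ :&: _ = [set z]) ?cards1 //; apply/setP=> s; rewrite !inE.
  apply/andP/eqP => [[zs /lcosetP[w E1w es]] | ->]; last first.
    by rewrite mem_basic_set // mem_lcoset mulVg group1.
  move: zs; rewrite es -(commuteEP (EE1 E1w) Pz) => zw.
  have [-> | ntw] := eqVneq w 1; first by rewrite mul1g.
  by case/existsP: z_only; exists w; rewrite E1w ntw.
have cyP : P \subset 'C(<[y]>).
  by apply: (sub_abelian_cent2 cGG); rewrite ?subPG // cycle_subG sEG.
have UE : <[y]> <*> P = <[y]> * P by apply: cent_joinEr.
have UP x : x \in <[y]> * P -> x != 1 -> x \in cl z.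
  by case/mulsgP=> w t yw Pt ->; apply: zU.
(* Conversely, x shares its E1-coset with some w t already in the basic set, and uniqueness gives x
   = w t. *)
have zUP x : x \in cl z -> x \in <[y]> * P.
  move=> zx; have [v [t [Ev Pt ex]]] := mulEPP (clG zx).
  move: Ev; rewrite -yE1E => /mulsgP[w e' yw E1e' ev].
  have Ew : w \in E by apply: subsetP yw; rewrite cycle_subG.
  have ex' : x = w * t * e'.
    by rewrite ex ev -!mulgA (commuteEP (EE1 E1e') Pt).
  have [wt1 | ntwt] := eqVneq (w * t) 1.
    by have := nE1_cl Gz nE1z zx; rewrite ex' wt1 mul1g E1e'.
  have zwt := zU w t yw Pt ntwt; have nwt := nE1_cl Gz nE1z zwt.
  have /eqP := card_coset_outside Gz nE1z (clG zwt) nwt Gz nE1z.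
  rewrite card1 => /cards1P[x1 eqx1].
  have : w * t \in [set x1] by rewrite -eqx1 inE zwt mem_lcoset mulVg group1.
  have : x \in [set x1] by rewrite -eqx1 inE zx mem_lcoset ex' mulKg.
  by move=> /set1P-> /set1P<-; apply: mem_mulg.
have clz : cl z = (<[y]> <*> P) :\ 1.
  apply/setP=> x; rewrite 2!inE UE; apply/idP/andP => [zx | [ntx Ux]].
    split; last exact: zUP.
    by apply: contraNneq (nE1_cl Gz nE1z zx) => ->; apply: group1.
  exact: UP.
exists (<[y]> <*> P)%G; split=> [|||x Ux ntx] /=.
- rewrite -(setD1K (group1 (<[y]> <*> P))) -clz.
  by rewrite sring_setU ?sring_set1 ?sring_set_basic.
- rewrite dprodE.
  + rewrite /= UE; apply/setP=> g; apply/idP/idP => [/mulsgP[x1 e1 Ux1 E1e1 ->] | Gg].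
      rewrite groupM ?(sEG (EE1 E1e1)) //; case/mulsgP: Ux1 => w t yw Pt ->.
      by rewrite mulEP_mem //; apply: subsetP yw; rewrite cycle_subG.
    have [v [t [Ev Pt ->]]] := mulEPP Gg.
    move: Ev; rewrite -yE1E => /mulsgP[w e' yw E1e' ->].
    rewrite -mulgA (commuteEP (EE1 E1e') Pt) mulgA.
    by apply: mem_mulg => //; apply: mem_mulg.
  + apply: (sub_abelian_cent2 cGG); first exact: (subset_trans sE1E subEG).
    by rewrite join_subG cycle_subG sEG ?subPG.
  apply/trivgP/subsetP=> x; rewrite inE => /andP[Ux E1x]; apply/set1P.
  apply/eqP; apply: contraLR E1x => ntx; apply: (nE1_cl Gz nE1z).
  by rewrite clz 2!inE ntx.
- exact: joing_subr.
by rewrite -clz; apply: basic_set_eq; rewrite clz 2!inE ntx.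
Qed.


(** * The tensor decomposition along U and E1 *)

Section Tensor.

Variable U : {group gT}.
Hypotheses (AU : sring_set A U) (defUE1 : U \x E1 = G) (sPU : P \subset U).
Hypothesis clU : forall x, x \in U -> x != 1 -> cl x = U :\ 1.

Let Ux_outside x e : x \in U -> x != 1 -> e \in E1 -> x * e \in G /\ x * e \notin E1.
Proof.
move=> Ux ntx E1e; have Gx := subsetP (sring_setS AU) x Ux.
split; first by rewrite groupM // sEG ?EE1.
rewrite groupMr //; apply: contraNN ntx => E1x.
have [_ _ _ tiUE1] := dprodP defUE1.
by apply/eqP/set1P; rewrite -[[set 1]]tiUE1 inE Ux.
Qed.

Let mulUE1_eq x y e f : x \in U -> y \in U -> e \in E1 -> f \in E1 ->
  x * e = y * f -> x = y /\ e = f.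
Proof.
move=> Ux Uy E1e E1f eq_xy; have [_ _ _ tiUE1] := dprodP defUE1.
have eq' : y^-1 * x = f * e^-1 by apply: (mulIg e); rewrite mulgKV -mulgA eq_xy mulKg.
have : y^-1 * x \in U :&: E1 by rewrite inE {2}eq' !groupM ?groupV.
rewrite tiUE1 => /set1P yx1; move: (yx1); rewrite eq' => /eqP.
rewrite -eq_mulgV1 => /eqP ->; split=> //.
by apply/esym/eqP; rewrite eq_mulVg1 yx1.
Qed.

(** All slices have the size of the one at z, which lies in z cl(e). If cl(e) had two elements and
    this slice were the single point w z, then w would be the only u in E whose slice along uP has
    size not divisible by p. So {w^p} would be an A-set inside cl(e), a contradiction. *)
Let card_slice x e g : x \in U -> x != 1 -> e \in E1 -> g \in U -> g != 1 ->
  #|cl e| <= #|cl (x * e) :&: g *: E1|.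
Proof.
move=> Ux ntx E1e Ug ntg.
have [Gxe nxe] := Ux_outside Ux ntx E1e.
have [] := Ux_outside Ug ntg (group1 E1); rewrite mulg1 => Gg ng.
have [z Pz ntz] := exists_generatorP; have nE1z := E1_P Pz ntz.
have Uz := subsetP sPU z Pz; have Gz := sPG Pz.
rewrite (card_coset_outside Gxe nxe Gg ng Gz nE1z).
have sub : cl (x * e) :&: z *: E1 \subset z *: cl e.
  apply/subsetP=> s; rewrite inE => /andP[xes /lcosetP[w E1w es]].
  have : s \in cl x * cl e.
    have AM := sring_setM (sring_set_basic A x) (sring_set_basic A e).
    apply: sring_set_closed AM _ xes; apply: mem_mulg; apply: mem_basic_set.
      exact: (subsetP (sring_setS AU)).
    exact/sEG/EE1.
  rewrite (clU Ux ntx) => /mulsgP[g' e' /setD1P[_ Ug'] ee' es'].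
  have [|_ ew] := mulUE1_eq Uz Ug' E1w (E1_basic E1e ee'); first by rewrite -es.
  by rewrite es mem_lcoset mulKg ew.
have /set0Pn[s] : cl (x * e) :&: z *: E1 != set0.
  have /mulsgP[y f xey E1f ez] := cover_outside Gxe nxe Gz nE1z.
  by apply/set0Pn; exists y; rewrite inE xey -(mulgK f y) -ez mem_lcoset mulKg groupV.
have [cle1 | cle_gt1] := leqP #|cl e| 1.
  by move=> xes; rewrite (leq_trans cle1) // card_gt0; apply/set0Pn; exists s.
have [e1 | nte] := eqVneq e 1; first by rewrite e1 basic_set1 cards1 in cle_gt1.
move=> xes; have /lcosetP[w ew es] := subsetP sub s xes.
have E1w := E1_basic E1e ew.
have cl_e_cases u : u \in cl e -> u = e \/ u = e^-1.
  move=> eu; have [u1|->|->] := card3_cases cardE1 E1e nte (E1_basic E1e eu); auto.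
  by case/eqP: nte; have := basic_set_sym (sEG (EE1 E1e)) eu; rewrite u1 basic_set1 => /set1P.
have clV : cl e = [set e; e^-1].
  apply/eqP; rewrite eqEcard; apply/andP; split.
    by apply/subsetP=> u /cl_e_cases[->|->]; rewrite !inE eqxx ?orbT.
  by rewrite (leq_trans _ cle_gt1) // cards2; case: (_ != _).
have cle2 : #|cl e| <= 2 by rewrite clV cards2; case: (_ != _).
apply: leq_trans cle2 _; rewrite ltnNge; apply/negP => le1.
have only_s u : u \in cl (x * e) :&: z *: E1 -> u = s.
  move=> xeu; apply/eqP; apply: contraLR le1 => nus; rewrite -ltnNge.
  by rewrite (cardsD1 s) xes (cardsD1 u) in_setD1 nus xeu.
have zw : s = w * z by rewrite es (commuteEP (EE1 E1w) Pz).
have xewz : w * z \in cl (x * e) by rewrite -zw; case/setIP: xes.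
have AX := sring_set_basic A (x * e).
have AT := sring_set_root_p AX; set T := [set _ | _ in _] in AT.
have stab := stable_outside Gxe nxe.
(* For u outside E1 the slice along uP is empty or full. For u in E1 a nonempty slice contains u z
   by the multipliers of P, which forces u = w. *)
have TE v : v \in T -> v = w ^+ p.
  case/imsetP=> u; rewrite inE => /andP[Eu nu] ->; congr (_ ^+ _).
  have /set0Pn[s' /setIP[xes' /lcosetP[t Pt es']]] : cl (x * e) :&: u *: P != set0.
    by apply: contraNneq nu => ->; rewrite cards0 dvdn0.
  rewrite es' in xes'; have [E1u | nE1u] := boolP (u \in E1).
    have ntt : t != 1.
      by apply: contraNneq (nE1_cl Gxe nxe xes') => ->; rewrite mulg1.
    have /only_s : u * z \in cl (x * e) :&: z *: E1.
      by rewrite inE (stab _ _ _ Eu Pt ntt Pz ntz xes') (commuteEP Eu Pz) mem_lcoset mulKg.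
    by rewrite zw => /mulIg.
  case/negP: nu; rewrite (setIidPr _) ?card_lcoset ?cardP ?dvdnn //.
  apply/subsetP=> _ /lcosetP[t' Pt' ->].
  exact: (coset_stable Eu nE1u Pt).
have wT : w ^+ p \in T.
  apply: imset_f; rewrite inE (EE1 E1w) /=.
  (* The slice is w P without w, which lies in E1: p - 1 points. *)
  rewrite (_ : _ :&: _ = w *: (P :\ 1)).
    have -> : #|w *: (P :\ 1)| = p.-1.
      by rewrite card_lcoset -cardP (cardsD1 1 P) group1.
    by case: (p) p_gt3 => [|[|m]] // _; rewrite gtnNdvd.
  apply/setP=> s'; rewrite inE !mem_lcoset !inE.
  have [Pws | _] := boolP (w^-1 * s' \in P); last by rewrite !andbF.
  rewrite !andbT; set t := w^-1 * s' in Pws *.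
  have -> : s' = w * t by rewrite mulKVg.
  clearbody t.
  apply/idP/idP => [xewt | ntt].
    by apply: contraNneq (nE1_cl Gxe nxe xewt) => ->; rewrite mulg1.
  exact: (stab _ _ _ (EE1 E1w) Pz ntz Pws ntt xewz).
have ntw : w != 1.
  apply: contraNneq nte => w1; have := basic_set_sym (sEG (EE1 E1e)) ew.
  by rewrite w1 basic_set1 => /set1P ->.
have ewp : w ^+ p \in cl e.
  have [wp1|->|->] := card3_cases cardE1 E1w ntw (groupX p E1w) => //.
    case/eqP: ntw; apply: (expg_p_inj (EE1 E1w) (group1 E)).
    by rewrite wp1 expg1n.
  by rewrite clV; case: (cl_e_cases w ew) => ->; rewrite !inE ?invgK eqxx ?orbT.
have /subset_leq_card : cl e \subset [set w ^+ p].
  apply/subsetP=> u eu; rewrite inE; apply/eqP/TE.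
  by apply: sring_set_closed AT wT _; rewrite (basic_set_eq ewp).
by rewrite cards1 leqNgt cle_gt1.
Qed.

(** For nontrivial x each slice of cl(xe) lies in a translate of cl(e) and is at least as large by
    [card_slice], so it fills the translate. *)
Lemma basic_setM x e : x \in U -> e \in E1 -> cl (x * e) = cl x * cl e.
Proof.
move=> Ux E1e; have [-> | ntx] := eqVneq x 1.
  by rewrite mul1g basic_set1 mul1g.
have Gx := subsetP (sring_setS AU) x Ux; have Ge := sEG (EE1 E1e).
have AM := sring_setM (sring_set_basic A x) (sring_set_basic A e).
have sub : cl (x * e) \subset cl x * cl e.
  by apply: sring_set_sub AM _; apply: mem_mulg; apply: mem_basic_set.
apply/eqP; rewrite eqEsubset sub; apply/subsetP=> _ /mulsgP[g f xg ef ->].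
have := xg; rewrite (clU Ux ntx) => /setD1P[ntg Ug].
have subg : cl (x * e) :&: g *: E1 \subset g *: cl e.
  apply/subsetP=> s; rewrite inE => /andP[xes /lcosetP[w E1w es]].
  move: (subsetP sub s xes); rewrite (clU Ux ntx) => /mulsgP[g' e' /setD1P[_ Ug'] ee' es'].
  have [|_ ew] := mulUE1_eq Ug Ug' E1w (E1_basic E1e ee'); first by rewrite -es.
  by rewrite es mem_lcoset mulKg ew.
have /eqP : cl (x * e) :&: g *: E1 == g *: cl e.
  by rewrite eqEcard subg card_lcoset card_slice.
by move/setP/(_ (g * f)); rewrite inE [in RHS]mem_lcoset mulKg ef => /andP[].
Qed.

Lemma core3_tensor : exists (G1 G2 : {group gT}) (A1 : sring G1) (A2 : sring G2),
  [/\ G2 \isog Zp 3, trivial_sring A1 & is_tensor_product A A1 A2].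
Proof.
have [A1 bA1] := exists_sring_restriction AU.
have [A2 bA2] := exists_sring_restriction AE1.
exists U, E1, A1, A2; split.
- rewrite isog_cyclic_card ?prime_cyclic ?cardE1 //=.
    by rewrite card_Zp.
  by rewrite card_Zp.
- have [x Ux ntx] : exists2 x, x \in U & x != 1.
    by have [z Pz ntz] := exists_generatorP; exists z; rewrite ?(subsetP sPU).
  have Gx := subsetP (sring_setS AU) x Ux.
  rewrite /trivial_sring /sring_rank bA1 (_ : finset _ = [set 1%g; U :\ 1]).
    rewrite cards2; suff -> : 1%g != U :\ 1 by [].
    apply/eqP => eU; have : (1 : gT) \in (1 : {set gT}) by apply: set11.
    by rewrite eU !inE eqxx.
  apply/setP=> Y; rewrite !inE; apply/andP/orP => [[/basic_setsP[y Gy ->] yU] | ].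
    have [-> | nty] := eqVneq y 1; first by rewrite basic_set1 eqxx; left.
    by right; rewrite clU // (subsetP yU) ?mem_basic_set.
  case=> /eqP->; first by rewrite basic_1 sub1set.
  by rewrite -(clU Ux ntx) basic_setP // sring_set_sub.
split=> //; apply/setP=> X; have [_ mulUE1 _ _] := dprodP defUE1.
apply/idP/imset2P => [/basic_setsP[g + ->] | [X1 X2]].
  rewrite -{1}mulUE1 => /mulsgP[x e Ux E1e ->].
  exists (cl x) (cl e); last exact: basic_setM.
    by rewrite bA1 inE basic_setP ?sring_set_sub // (subsetP (sring_setS AU)).
  by rewrite bA2 inE basic_setP ?sring_set_sub // sEG ?EE1.
rewrite bA1 bA2 !inE => /andP[/basic_setsP[x Gx ->] xU] /andP[/basic_setsP[e Ge ->] eE1] ->.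
have Ux : x \in U by rewrite (subsetP xU) ?mem_basic_set.
have E1e : e \in E1 by rewrite (subsetP eE1) ?mem_basic_set.
by rewrite -basic_setM // basic_setP // groupM.
Qed.

End Tensor.

End Core3.

Lemma proper_core_cases :
  [\/ trivial_sring A,
      exists (G1 G2 : {group gT}) (A1 : sring G1) (A2 : sring G2),
        [/\ G2 \isog Zp 3, trivial_sring A1 & is_tensor_product A A1 A2]
    | exists U L : {group gT}, is_proper_wreath_product A U L /\ #|U / L| <= 3].
Proof.
case: sring_set_core_mul_or => [/wreath_core_mul | ]; first by constructor 3.
case=> u [z [v [[E1u Pz ntz] [Ev nE1v uzv]]]].
have := card_coreE_le3; rewrite leq_eqVlt => /predU1P[cardE1 | lt3].
  have cover_uz x : x \in G -> x \notin E1 -> x \in cl (u * z) * E1.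
    move=> Gx nx; have := mixed_core3 E1u Pz ntz Ev nE1v uzv cardE1 Gx.
    by rewrite inE (negbTE nx) orbF.
  have [|[U [AU defU sPU clU]]] := core3_wreath_or_tensor cardE1 cover_uz.
    by constructor 3.
  by constructor 2; apply: (core3_tensor cardE1 cover_uz AU defU sPU clU).
have cardE1 : #|E1| = 1%N.
  have: #|E1| %| 3 ^ 2 by rewrite -[(3 ^ 2)%N]cardE9 cardSg.
  by case/(dvdn_pfactor _ _ (erefl : prime 3)) => [[|[|[|//]]]] _ e; rewrite e in lt3 *.
have [] := mixed_core1 E1u Pz ntz Ev nE1v uzv cardE1; first by constructor 1.
by constructor 3.
Qed.

End ProperCore.

(** Inversion fixes no nontrivial element of E, so it pairs off everything except the identity. *)
Lemma odd_card_symmetric (S : {set gT}) : S \subset E ->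
  (forall x, x \in S -> x^-1 \in S) -> odd #|S| = (1 \in S).
Proof.
have even_card (T : {set gT}) : T \subset E -> (forall x, x \in T -> x^-1 \in T) ->
    1 \notin T -> odd #|T| = false.
  have [n] := ubnP #|T|; elim: n => // n IHn in T *; rewrite ltnS => leTn sTE Tsym nT1.
  have [->|[x Tx]] := set_0Vmem T; first by rewrite cards0.
  have ntx : x != 1 by apply: contraNneq nT1 => <-.
  have nxV : x^-1 != x.
    apply: contraNneq ntx => xV; have := invgE_exp (subsetP sTE x Tx).
    by rewrite xV expgS expg1 => /(canRL (mulKg x)) ->; rewrite mulVg.
  have TxV : x^-1 \in T :\ x by rewrite in_setD1 nxV Tsym.
  rewrite (cardsD1 x) Tx (cardsD1 x^-1) TxV /= negbK; apply: IHn.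
  - apply: leq_trans leTn; rewrite (cardsD1 x T) Tx.
    by rewrite (cardsD1 x^-1 (T :\ x)) TxV; apply: ltnW.
  - by apply: subset_trans sTE; apply: subset_trans (subD1set _ _) (subD1set _ _).
  - move=> y; rewrite !in_setD1 => /and3P[nyV nyx Ty].
    by rewrite Tsym // andbT (inj_eq invg_inj) nyx -(inj_eq invg_inj) invgK.
  by rewrite !in_setD1 (negbTE nT1) !andbF.
move=> sSE Ssym; have [S1 | nS1] := boolP (1 \in S); last exact: even_card.
rewrite (cardsD1 1) S1 /= even_card //.
- by rewrite (subset_trans (subD1set _ _)).
- by move=> x; rewrite !in_setD1 => /andP[ntx Sx]; rewrite Ssym // invg_eq1 ntx.
by rewrite in_setD1 eqxx.
Qed.

Lemma slice_lcoset (S : {set gT}) t : t \in P ->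
  S :&: t *: E = t *: [set u in E | u * t \in S].
Proof.
move=> Pt; apply/setP=> x; rewrite !inE !mem_lcoset inE.
case Etx: (t^-1 * x \in E); rewrite ?andbF //= andbT.
by rewrite (commuteEP Etx Pt) mulKVg.
Qed.

Lemma lcoset_mulE u t : u \in E -> t \in P -> (u * t) *: E = t *: E.
Proof. by move=> Eu Pt; rewrite (commuteEP Eu Pt) lcosetM lcoset_id. Qed.

(** * E is an A-subgroup and P is not *)

Section OnlyESubgroup.

Hypotheses (AE : sring_set A E) (nAP : ~~ sring_set A P).

(** Otherwise the cube argument gives an A-set inside P containing a nontrivial element; it
    generates P, which would be an A-subgroup. *)
Lemma slices_dvd3 x : x \in G -> x \notin E -> 3 %| #|cl x :&: x *: E|.
Proof.
move=> Gx nEx; apply: contraNT nAP => nd.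
have [u [z [Eu Pz ex]]] := mulEPP Gx.
have ntz : z != 1 by apply: contraNneq nEx => z1; rewrite ex z1 mulg1.
have AT := sring_set_root_3 (sring_set_basic A x); set T := [set _ | _ in _] in AT.
have Tz : z ^+ 3 \in T by apply: imset_f; rewrite inE Pz -(lcoset_mulE Eu Pz) -ex.
have sTP : <<T>> \subset P.
  rewrite gen_subG; apply/subsetP=> _ /imsetP[t + ->]; rewrite inE => /andP[Pt _].
  exact: groupX.
suff <- : <<T>> = P by apply: sring_set_gen.
apply/eqP; rewrite eqEcard sTP cardP.
have ntz3 : z ^+ 3 != 1.
  by apply: contraNneq ntz => z3; apply/eqP/(expg_3_inj Pz (group1 P)); rewrite z3 expg1n.
have <- : #[z ^+ 3] = p by apply: nt_prime_order => //; apply/expP/groupX.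
by rewrite dvdn_leq ?cardG_gt0 // order_dvdG // mem_gen.
Qed.

Lemma only_E_wreath :
  exists U L : {group gT}, is_proper_wreath_product A U L /\ #|U / L| <= 3.
Proof.
have [z Pz ntz] := exists_generatorP.
have nEP t : t \in P -> t != 1 -> t \notin E.
  move=> Pt; apply: contraNN => Et; apply/eqP.
  have [|//] := @mulEP_eq t 1 1 t Et (group1 P) (group1 E) Pt.
  by rewrite mulg1 mul1g.
have outE x : x \in G -> x \notin E ->
    exists u t, [/\ u \in E, t \in P, t != 1 & x = u * t].
  move=> Gx nEx; have [u [t [Eu Pt ex]]] := mulEPP Gx; exists u, t; split=> //.
  by apply: contraNneq nEx => t1; rewrite ex t1 mulg1.
have nEcl x y : x \in G -> x \notin E -> y \in cl x -> y \notin E.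
  by move=> Gx nEx xy; rewrite (mem_sring_set AE Gx xy).
have nEG : E :!=: G by apply: contraNneq (nEP z Pz ntz) => ->; apply: sPG.
have twist_cl t t' v : t \in P -> t != 1 -> t' \in P -> t' != 1 -> v \in E ->
    v * t \in cl t -> v * t' \in cl t'.
  move=> Pt ntt Pt' ntt' Ev; have [k co_k ->] := generatorP Pt ntt Pt' ntt'.
  by have := twistP (group1 E) Pt Ev Pt co_k; rewrite !mul1g.
pose L := [set u in E | u * z \in cl z].
have sLE : L \subset E by apply/subsetP=> u; rewrite inE => /andP[].
have L1 : 1 \in L by rewrite inE group1 mul1g mem_basic_set ?sPG.
have Lsym u : u \in L -> u^-1 \in L.
  rewrite !inE groupV => /andP[Eu zu]; rewrite Eu /=.
  by have := flipE (group1 E) Pz Eu Pz; rewrite invg1 mul1g; apply.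
have cardLE : #|cl z :&: z *: E| = #|L| by rewrite slice_lcoset ?card_lcoset.
have L_dvd3 : 3 %| #|L| by rewrite -cardLE slices_dvd3 ?nEP ?sPG.
have oddL : odd #|L| by rewrite odd_card_symmetric.
have leL9 : #|L| <= 9 by rewrite -cardE9 subset_leq_card.
have [leL3 | gtL3] := leqP #|L| 3; last first.
  (* An odd multiple of 3 above 3 and at most 9 is 9. Twisting then puts tE inside the basic set of
     each nontrivial t in P, and both subgroups of the section are E. *)
  have LE : L = E.
    apply/eqP; rewrite eqEcard sLE cardE9.
    by case/dvdnP: L_dvd3 oddL leL9 gtL3 => [[|[|[|[|m]]]]] ->.
  apply: (@proper_wreath_intro _ _ _ cGG E E) => //.
  - by rewrite -cardG_gt1 cardE9.
  - by rewrite leq_pmull.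
  move=> x Gx nEx; apply/subsetP=> w Ew; apply/stabilizerP; split; first exact: sEG.
  move=> y xy; have Gy := subsetP (basic_set_sub A x) y xy.
  have [v [t [Ev Pt ntt ey]]] := outE y Gy (nEcl x y Gx nEx xy).
  have in_cl v' : v' \in E -> v' * t \in cl t.
    move=> Ev'; apply: (twist_cl z) => //.
    by have := Ev'; rewrite -LE inE Ev'.
  rewrite -(basic_set_eq xy) ey (basic_set_eq (in_cl v Ev)) mulgA in_cl //.
  exact: groupM.
have cardL : #|L| = 3.
  by case/dvdnP: L_dvd3 oddL leL3 => [[|[|m]]] ->.
have [e Le nte] : exists2 e, e \in L & e != 1.
  have : L :\ 1 != set0.
    by apply: contra_eq_neq cardL => L10; rewrite (cardsD1 1 L) L1 L10 cards0.
  by case/set0Pn=> e /setD1P[]; exists e.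
have Ee := subsetP sLE e Le.
have oe : #[e] = 3 by apply: nt_prime_order nte => //; apply: expE.
have LE : <[e]> = L.
  apply/eqP; rewrite eqEcard cardL -orderE oe leqnn andbT.
  apply/subsetP=> w ew; have [->|->|->] := card3_cases oe (cycle_id e) nte ew => //.
  exact: Lsym.
have Lcl w t : w \in <[e]> -> t \in P -> t != 1 -> w * t \in cl t.
  move=> ew Pt ntt; apply: (twist_cl z) => //; first by rewrite (subsetP sLE) -?LE.
  by move: ew; rewrite LE inE => /andP[].
(* A nonempty slice of cl z along tE has 3 points, like the one at z. It is closed under inverting
   the E-component, so oddness puts t in it, and a twist identifies it with L. *)
have cl_zP v t : v \in E -> t \in P -> v * t \in cl z ->
    [/\ t != 1, cl t = cl z & v \in <[e]>].
  move=> Ev Pt zvt; have Gz := sPG Pz.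
  have ntt : t != 1.
    by apply: contraNneq (nEcl z _ Gz (nEP z Pz ntz) zvt) => ->; rewrite mulg1.
  pose Lt := [set u in E | u * t \in cl z].
  have zt : t \in cl z.
    suff : 1 \in Lt by rewrite inE mul1g => /andP[].
    rewrite -odd_card_symmetric; last 2 first.
    - by apply/subsetP=> u; rewrite inE => /andP[].
    - move=> u; rewrite !inE groupV => /andP[Eu zut]; rewrite Eu /=.
      by have := flipE (group1 E) Pz Eu Pt; rewrite invg1 mul1g; apply.
    rewrite -(card_lcoset _ t) -slice_lcoset // -(lcoset_mulE Ev Pt).
    by rewrite (card_lcoset_basic (sring_set_basic A z) AE Gz zvt) cardLE cardL.
  have clt := basic_set_eq zt; split=> //.
  rewrite LE inE Ev /=; apply: (twist_cl t) => //.
  by rewrite clt.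
have AL : sring_set A <[e]>.
  (* This exhibits L as an intersection of two A-subgroups. *)
  have -> : <[e]> = stabilizer G (cl z) :&: E.
    apply/setP=> w; rewrite in_setI; apply/idP/andP => [ew | [/stabilizerP[_ wz] Ew]].
      have Ew : w \in E by apply: subsetP ew; rewrite cycle_subG.
      split=> //; apply/stabilizerP; split; first exact: sEG.
      move=> y zy; have [v [t [Ev Pt ey]]] := mulEPP (subsetP (basic_set_sub A z) y zy).
      rewrite ey in zy *; have [ntt <- ev] := cl_zP v t Ev Pt zy.
      by rewrite mulgA Lcl // groupM.
    by rewrite LE inE Ew wz // mem_basic_set ?sPG.
  by rewrite sring_setI ?sring_set_stabilizer ?sring_set_basic.
have sLgE : <[e]> \subset E by rewrite cycle_subG.
have sLgG := subset_trans sLgE subEG.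
apply: (@proper_wreath_intro _ _ _ cGG E <[e]>) => //.
- by rewrite /= cycle_eq1.
- by rewrite /= cardE9 -orderE oe.
move=> x Gx nEx; have AX := sring_set_basic A x.
have constL y : y \in cl x -> #|cl x :&: y *: <[e]>| = #|cl x :&: x *: <[e]>|.
  exact: (card_lcoset_basic AX AL Gx).
suff full : #|cl x :&: x *: <[e]>| = 3.
  apply/subsetP=> w ew; apply/stabilizerP; split; first exact: (subsetP sLgG).
  move=> y xy; have Gy := subsetP (basic_set_sub A x) y xy.
  have sub : y *: <[e]> \subset cl x.
    by apply/setIidPr/eqP; rewrite eqEcard subsetIr constL // full card_lcoset -orderE oe.
  apply: (subsetP sub); rewrite (centsP cGG w (subsetP sLgG w ew) y Gy).
  by rewrite mem_lcoset mulKg.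
have [u [t [Eu Pt ntt ex]]] := outE x Gx nEx; have Gt := sPG Pt.
(* If cl x meets t L it equals cl t, which is known. Otherwise its slice along x E misses one of the
   three cosets of L. *)
have [empty | [s]] := set_0Vmem (cl x :&: t *: <[e]>); last first.
  case/setIP=> xs /lcosetP[w ew es].
  have Ew := subsetP sLgE w ew.
  have ts : s \in cl t by rewrite es -(commuteEP Ew Pt) Lcl.
  have clxt : cl x = cl t by rewrite -(basic_set_eq xs) (basic_set_eq ts).
  rewrite -(constL t); last by rewrite clxt mem_basic_set.
  rewrite (setIidPr _) ?card_lcoset -?orderE ?oe //.
  apply/subsetP=> _ /lcosetP[w' ew' ->]; rewrite clxt.
  by rewrite -(commuteEP (subsetP sLgE w' ew') Pt) Lcl.
have neu : u \notin <[e]>.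
  apply/negP => eu; have : x \in set0; last by rewrite inE.
  by rewrite -empty inE mem_basic_set // mem_lcoset ex (commuteEP Eu Pt) mulKg.
have [ou uLE] := mulE_cycle sLgE oe Eu neu.
have ntu : u != 1 by apply: contraNneq neu => ->; apply: group1.
set n := #|_|; set y := u^-1 * t.
have n_bound : 0 < n <= 3.
  apply/andP; split; last first.
    by rewrite -oe orderE -(card_lcoset _ x) subset_leq_card ?subsetIr.
  rewrite card_gt0; apply/set0Pn; exists x.
  by rewrite inE mem_basic_set // mem_lcoset mulVg group1.
have ny : #|cl x :&: y *: <[e]>| = 0%N \/ #|cl x :&: y *: <[e]>| = n.
  have [->|[s]] := set_0Vmem (cl x :&: y *: <[e]>); first by left; rewrite cards0.
  case/setIP=> xs ys; right; rewrite /n -(constL s) //.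
  by rewrite (lcoset_eqP ys).
have uu : u * u = u^-1 by rewrite -invgE_exp // expgS expg1.
(* The remaining cosets are x L and y L. Each meets cl x in 0 or n points, so the slice has n or 2 n
   points; divisibility by 3 with 0 < n <= 3 forces n = 3. *)
have split_slice : cl x :&: x *: E = (cl x :&: x *: <[e]>) :|: (cl x :&: y *: <[e]>).
  rewrite -setIUr; apply/setP=> s; rewrite !in_setI; case xs: (s \in cl x) => //=.
  rewrite in_setU; apply/idP/orP => [|[]] /lcosetP[w Ew es].
  - move: Ew es; rewrite -{1}uLE => /mulsgP[u' w' uu' ew' ->] es.
    have Eu' : u' \in E by apply: subsetP uu'; rewrite cycle_subG.
    have es' : s = (u * u') * t * w'.
      by rewrite es ex -(mulgA u u') (commuteEP Eu' Pt) !mulgA.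
    have [u1|u1|u1] := card3_cases ou (cycle_id u) ntu uu'.
    + by left; rewrite es' u1 mulg1 -ex mem_lcoset mulKg.
    + by right; rewrite es' u1 uu mem_lcoset mulKg.
    have : s \in set0; last by rewrite inE.
    by rewrite -empty inE xs es' u1 mulgV mul1g mem_lcoset mulKg.
  - by rewrite es mem_lcoset mulKg (subsetP sLgE).
  rewrite ex (lcoset_mulE Eu Pt) -(@lcoset_mulE u^-1) ?groupV //.
  by rewrite es mem_lcoset mulKg (subsetP sLgE).
have disj : (cl x :&: x *: <[e]>) :&: (cl x :&: y *: <[e]>) = set0.
  apply/eqP; apply: contraNT neu => /set0Pn[s].
  case/setIP=> /setIP[_ xs] /setIP[_ ys].
  have : x \in y *: <[e]> by rewrite -(lcoset_eqP ys) (lcoset_eqP xs) mem_lcoset mulVg group1.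
  have ey : y = t * u^-1 := commuteEP (groupVr Eu) Pt.
  by rewrite mem_lcoset ey ex (commuteEP Eu Pt) invMg invgK -mulgA mulKg uu groupV.
have := cardsUI (cl x :&: x *: <[e]>) (cl x :&: y *: <[e]>).
rewrite disj cards0 addn0 -split_slice -/n => card_slice.
have := slices_dvd3 Gx nEx; rewrite card_slice; clearbody n.
by case: ny n_bound => -> {card_slice}; case: n => [|[|[|[|m]]]].
Qed.

End OnlyESubgroup.

Lemma card_cycle_sols b c : b \in P -> b != 1 -> c \in P ->
  \sum_(l < p) (c * b ^+ l == 1)%g = 1%N.
Proof.
move=> Pb ntb Pc; have ob : #[b] = p by apply: nt_prime_order => //; apply: expP.
have PE : P :=: <[b]> by apply/esym/eqP; rewrite eqEcard cycle_subG Pb cardP -orderE ob /=.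
have /cycleP[m cm] : c^-1 \in <[b]> by rewrite -PE groupV.
have ltm : m %% p < p by rewrite ltn_mod prime_gt0.
have solE (l : 'I_p) : (c * b ^+ l == 1)%g = (l == Ordinal ltm).
  rewrite -eq_invg_mul cm eq_expg_mod_order ob (modn_small (ltn_ord l)).
  by rewrite -val_eqE eq_sym.
rewrite (eq_bigr (fun l : 'I_p => if l == Ordinal ltm then 1%N else 0%N)) => [|l _].
  by rewrite -big_mkcond big_pred1_eq.
by rewrite solE; case: (_ == _).
Qed.


(** * E and P are both A-subgroups *)

Section BothSubgroups.

Hypotheses (AE : sring_set A E) (AP : sring_set A P).

Lemma basic_set_projE u z v t : u \in E -> z \in P -> v \in E -> t \in P ->
  v * t \in cl (u * z) -> v \in cl u.
Proof.
move=> Eu Pz Ev Pt uzvt.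
have AM := sring_setM (sring_set_basic A u) AP.
have : u * z \in cl u * P by rewrite mem_mulg ?mem_basic_set ?sEG.
move/(sring_set_closed AM)/(_ uzvt)/mulsgP=> [y t' uy Pt' e].
have Ey : y \in E by apply: sring_set_closed AE Eu uy.
by have [-> _] := mulEP_eq Ev Pt Ey Pt' e.
Qed.

Lemma basic_set_projP u z v t : u \in E -> z \in P -> v \in E -> t \in P ->
  v * t \in cl (u * z) -> t \in cl z.
Proof.
move=> Eu Pz Ev Pt uzvt.
have AM := sring_setM AE (sring_set_basic A z).
have : u * z \in E * cl z by rewrite mem_mulg ?mem_basic_set ?sPG.
move/(sring_set_closed AM)/(_ uzvt)/mulsgP=> [y t' Ey zt' e].
have Pt' : t' \in P by apply: sring_set_closed AP Pz zt'.
by have [_ ->] := mulEP_eq Ev Pt Ey Pt' e.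
Qed.

Lemma dvdp_expP t k : t \in P -> p %| k -> t ^+ k = 1.
Proof. by move=> Pt /dvdnP[m ->]; rewrite mulnC expgM expP // expg1n. Qed.

Lemma twist_all u z v t k : u \in E -> z \in P -> v \in E -> t \in P ->
  v * t \in cl (u * z) -> v * t ^+ k \in cl (u * z ^+ k).
Proof.
move=> Eu Pz Ev Pt uzvt; have [co_k | ] := boolP (coprime p k); first exact: twistP.
rewrite prime_coprime // negbK => pk; rewrite !dvdp_expP // !mulg1.
exact: basic_set_projE uzvt.
Qed.

(** The exponent acting as the identity on E and as the k-th power on P; for k = 0 it is the
    projection onto E. *)
Definition twist_exp k := chinese 3 p 1 k.

Lemma expg_twist u z k : u \in E -> z \in P -> (u * z) ^+ twist_exp k = u * z ^+ k.
Proof.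
move=> Eu Pz; rewrite (@expg_mulEP _ _ _ 1 k) //.
  by rewrite /twist_exp chinese_modl ?p_coprime3.
by rewrite /twist_exp chinese_modr ?p_coprime3.
Qed.

(** For k prime to p this is a multiplier. For p dividing k the multiplicity at g in E is |X ∩ gP|,
    an intersection number because P is an A-subgroup. *)
Lemma push_forward_twist_exp (X : {set gT}) k : sring_set A X ->
  push_forward (expgn^~ (twist_exp k)) X \in sring_pred A.
Proof.
move=> AX; have sXG := subsetP (sring_setS AX).
have [co_k | ] := boolP (coprime p k).
  have co := coprimeG_chinese (coprimen1 3) co_k.
  have AT := sring_set_expg cGG co AX.
  rewrite (_ : push_forward _ _ = simple_quantity [set s ^+ twist_exp k | s in X]).
    exact/sring_set_quantity.
  apply/ffunP=> g; rewrite !ffunE; congr (_%:R)%R.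
  case: imsetP => [[s Xs ->]|no]; last first.
    by apply: eq_card0 => s; rewrite !inE; apply/andP => -[Xs /eqP e]; case: no; exists s.
  rewrite (_ : [set _ in X | _] = [set s]) ?cards1 //.
  apply/setP=> t; rewrite !inE; apply/andP/eqP => [[Xt /eqP e]|->]; last by [].
  by rewrite -(expgK co (sXG t Xt)) /= e expgK ?sXG.
rewrite prime_coprime // negbK => pk.
have pushE g : #|[set s in X | s ^+ twist_exp k == g]|
    = if g \in E then #|X :&: g *: P| else 0.
  case: ifP => [Eg | nEg].
    apply: eq_card => s; rewrite !inE; case Xs: (s \in X) => //=.
    have [v [t [Ev Pt ->]]] := mulEPP (sXG s Xs).
    rewrite expg_twist // dvdp_expP // mulg1 mem_lcoset.
    apply/eqP/idP => [-> | Pt']; first by rewrite mulKg.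
    by have [|<- //] := mulEP_eq Eg Pt' Ev Pt; rewrite mulKVg.
  apply: eq_card0 => s; rewrite !inE; apply/andP=> -[Xs /eqP e]; case/negP: nEg.
  have [v [t [Ev Pt es]]] := mulEPP (sXG s Xs).
  by rewrite -e es expg_twist // dvdp_expP // mulg1.
apply/sring_predP; split=> [g nGg | g g' Gg gg']; rewrite !ffunE !pushE.
  by case: ifP => // /sEG Gg; rewrite Gg in nGg.
by rewrite (mem_sring_set AE Gg gg') (card_lcoset_basic AX AP Gg gg').
Qed.

(** The coefficient of g in the product of the two twisted push-forwards. *)
Definition pair_count (X1 X2 : {set gT}) k l g :=
  \sum_(x1 in X1) \sum_(x2 in X2) (x1 ^+ twist_exp k * x2 ^+ twist_exp l == g)%g.

Lemma pair_count_basic X1 X2 k l g g' :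
    sring_set A X1 -> sring_set A X2 -> g \in G -> g' \in cl g ->
  pair_count X1 X2 k l g' = pair_count X1 X2 k l g.
Proof.
move=> AX1 AX2 Gg gg'.
have pcE h : ((push_forward (expgn^~ (twist_exp k)) X1
               * push_forward (expgn^~ (twist_exp l)) X2)%R h
              = (pair_count X1 X2 k l h)%:R)%R.
  rewrite !push_forwardE mulr_suml group_ring_sumE /pair_count natr_sum.
  apply: eq_bigr => x1 _; rewrite mulr_sumr group_ring_sumE natr_sum.
  by apply: eq_bigr => x2 _; rewrite simple_quantity1M ffunE inE eq_sym.
have /sring_predP[_ /(_ g g' Gg gg')] :=
  sring_predM (push_forward_twist_exp k AX1) (push_forward_twist_exp l AX2).
by rewrite !pcE => /eqP; rewrite eqr_nat => /eqP.
Qed.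


Lemma sum_eq_mem (X : {set gT}) c : \sum_(x in X) (x == c) = (c \in X).
Proof.
have [Xc | nXc] := boolP (c \in X).
  by rewrite (bigD1 c) //= eqxx big1 ?addn0 // => x /andP[_ /negbTE->].
by rewrite big1 // => x Xx; case: eqP Xx => // ->; rewrite (negbTE nXc).
Qed.

(** The orthogonality relation behind the inversion: if a or b is nontrivial, the exponent of a
    nontrivial one is determined by the other exponent. *)
Lemma card_pair_sols a b : a \in P -> b \in P ->
  \sum_(k < p) \sum_(l < p) (a ^+ k * b ^+ l == 1)%g
    = if (a == 1) && (b == 1) then (p * p)%N else p.
Proof.
move=> Pa Pb; have sum_const n : \sum_(k < p) n = (p * n)%N.
  by rewrite sum_nat_const card_ord.
have [-> | ntb] := eqVneq b 1; last first.
  rewrite andbF (eq_bigr (fun=> 1%N)) ?sum_const ?muln1 // => k _.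
  by rewrite card_cycle_sols // groupX.
rewrite andbT (eq_bigr (fun k : 'I_p => p * (1 * a ^+ k == 1)%g)%N) => [|k _]; last first.
  rewrite (eq_bigr (fun=> (1 * a ^+ k == 1)%g : nat)) ?sum_const // => l _.
  by rewrite expg1n mulg1 mul1g.
rewrite -big_distrr /=; have [-> | nta] := eqVneq a 1; last first.
  by rewrite card_cycle_sols // muln1.
congr (p * _)%N; rewrite (eq_bigr (fun=> 1%N)) ?sum_const ?muln1 // => k _.
by rewrite expg1n mulg1 eqxx.
Qed.

(** The structure constant at w for the colouring of E by the basic sets of u z. *)
Definition slice_count (X1 X2 : {set gT}) w z :=
  #|[set u in E | (u * z \in X1) && (u^-1 * w * z \in X2)]|.

(* Summing over the twists k, l is a discrete Fourier inversion on P: it      *)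
(* isolates the products of the slices of X1 and X2 at z.                     *)
Lemma sum_pair_count (X1 X2 : {set gT}) w z : X1 \subset G -> X2 \subset G ->
    w \in E -> z \in P ->
  \sum_(k < p) \sum_(l < p) pair_count X1 X2 k l (w * z ^+ (k + l))%g
    = (p * pair_count X1 X2 0 0 w + (p * p - p) * slice_count X1 X2 w z)%N.
Proof.
move=> sX1G sX2G Ew Pz.
pose D (u1 z1 u2 z2 : gT) :=
  ((u1 * u2 == w)%g * (p + ((z1 == z) && (z2 == z)) * (p * p - p)))%N.
have DE u1 z1 u2 z2 : u1 \in E -> z1 \in P -> u2 \in E -> z2 \in P ->
    \sum_(k < p) \sum_(l < p) ((u1 * z1) ^+ twist_exp k * (u2 * z2) ^+ twist_exp l
        == w * z ^+ (k + l))%g = D u1 z1 u2 z2.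
  move=> Eu1 Pz1 Eu2 Pz2; rewrite /D.
  have cond k l : ((u1 * z1) ^+ twist_exp k * (u2 * z2) ^+ twist_exp l == w * z ^+ (k + l))
      = (u1 * u2 == w) && ((z1 * z^-1) ^+ k * (z2 * z^-1) ^+ l == 1).
    have cP x y : x \in P -> y \in P -> commute x y.
      by move=> Px Py; apply: (centsP cGG); apply: sPG.
    rewrite !expg_twist // -(mulgA u1) (mulgA (z1 ^+ k)).
    rewrite -(commuteEP Eu2 (groupX k Pz1)) -(mulgA u2) (mulgA u1).
    rewrite !expgMn ?expgVn; try by apply: cP; rewrite ?groupV.
    have -> : z1 ^+ k * (z ^+ k)^-1 * (z2 ^+ l * (z ^+ l)^-1)
        = z1 ^+ k * z2 ^+ l * (z ^+ (k + l))^-1.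
      have PC : z2 ^+ l * (z ^+ l)^-1 \in P by rewrite groupM ?groupV ?groupX.
      have PD : (z ^+ k)^-1 \in P by rewrite groupV groupX.
      by rewrite expgD invMg -mulgA (cP _ _ PD PC) !mulgA.
    rewrite -eq_mulgV1.
    apply/eqP/andP => [e | [/eqP-> /eqP->]]; last by [].
    have Pzz : z1 ^+ k * z2 ^+ l \in P by apply: groupM; apply: groupX.
    by have [-> ->] := mulEP_eq (groupM Eu1 Eu2) Pzz Ew (groupX _ Pz) e.
  rewrite (eq_bigr (fun k : 'I_p => (u1 * u2 == w)%g *
      (\sum_(l < p) ((z1 * z^-1) ^+ k * (z2 * z^-1) ^+ l == 1)%g))%N) => [|k _]; last first.
    by rewrite big_distrr; apply: eq_bigr => l _ /=; rewrite cond mulnb.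
  rewrite -big_distrr card_pair_sols ?groupM ?groupV //= -!eq_mulgV1.
  congr (_ * _)%N; case: (_ && _); rewrite ?mul1n ?mul0n ?addn0 // subnKC //.
  by rewrite leq_pmulr ?prime_gt0.
pose e (x : gT) := x ^+ twist_exp 0; pose q x := (e x)^-1 * x.
have eE u t : u \in E -> t \in P -> e (u * t) = u.
  by move=> Eu Pt; rewrite /e expg_twist // mulg1.
have qE u t : u \in E -> t \in P -> q (u * t) = t.
  by move=> Eu Pt; rewrite /q eE // mulKg.
have exch (F : 'I_p -> 'I_p -> gT -> gT -> nat) :
    \sum_(k < p) \sum_(l < p) \sum_(x1 in X1) \sum_(x2 in X2) F k l x1 x2
    = \sum_(x1 in X1) \sum_(x2 in X2) \sum_(k < p) \sum_(l < p) F k l x1 x2.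
  transitivity (\sum_(x1 in X1) \sum_(k < p) \sum_(l < p) \sum_(x2 in X2) F k l x1 x2).
    by rewrite [RHS]exchange_big; apply: eq_bigr => k _; apply: exchange_big.
  apply: eq_bigr => x1 _.
  by rewrite [RHS]exchange_big; apply: eq_bigr => k _; apply: exchange_big.
rewrite exch.
pose S x1 x2 := (q x1 == z) && (x2 == (e x1)^-1 * w * z).
transitivity (\sum_(x1 in X1) \sum_(x2 in X2)
    (p * (e x1 * e x2 == w)%g + (p * p - p) * S x1 x2))%N.
  apply: eq_bigr => x1 X1x1; apply: eq_bigr => x2 X2x2.
  have [u1 [z1 [Eu1 Pz1 e1]]] := mulEPP (subsetP sX1G _ X1x1).
  have [u2 [z2 [Eu2 Pz2 e2]]] := mulEPP (subsetP sX2G _ X2x2).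
  have cond : (u1 * u2 == w) && ((z1 == z) && (z2 == z))
            = (z1 == z) && (u2 * z2 == u1^-1 * w * z).
    rewrite andbCA; congr (_ && _).
    apply/andP/eqP => [[/eqP <- /eqP ->] | e12]; first by rewrite mulKg.
    have [|-> ->] := mulEP_eq Eu2 Pz2 _ Pz e12; first by rewrite groupM ?groupV.
    by rewrite mulKVg !eqxx.
  rewrite e1 e2 DE // /D /S !eE // !qE // -cond.
  case: (u1 * u2 == w); rewrite ?mul0n ?muln0 // mul1n muln1 /=.
  by rewrite (mulnC (_ - _)%N).
under eq_bigr => x1 _ do rewrite big_split -!big_distrr /=.
rewrite big_split -!big_distrr /=; congr (_ + _ * _)%N.
transitivity #|[set x1 in X1 | (q x1 == z) && ((e x1)^-1 * w * z \in X2)]|.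
  rewrite -sum1dep_card big_mkcondr; apply: eq_bigr => x1 X1x1; rewrite /S.
  by case: eqP => _ /=; [rewrite sum_eq_mem; case: (_ \in _) | rewrite big1].
rewrite -[RHS](card_imset _ (mulIg z)); apply: eq_card => x.
rewrite inE; apply/idP/imsetP => [/and3P[X1x /eqP qx Xx2] | [u + ->]].
  have [u [t [Eu Pt ex]]] := mulEPP (subsetP sX1G x X1x).
  move: qx Xx2; rewrite ex qE // eE // => tz uX2.
  by exists u; rewrite -?tz // inE Eu tz uX2 -{1}tz -ex X1x.
rewrite inE => /and3P[Eu X1u X2u].
by rewrite X1u qE // eE // eqxx X2u.
Qed.

(** In the inversion formula every pair count is constant on basic sets, since twists and
    projections respect them; the factor p^2 - p is positive and cancels. *)
Lemma slice_count_basic (X1 X2 : {set gT}) w w' z z' :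
    sring_set A X1 -> sring_set A X2 -> w \in E -> z \in P -> w' \in E -> z' \in P ->
    w' * z' \in cl (w * z) ->
  slice_count X1 X2 w' z' = slice_count X1 X2 w z.
Proof.
move=> AX1 AX2 Ew Pz Ew' Pz' wzwz'.
have := sum_pair_count (sring_setS AX1) (sring_setS AX2) Ew' Pz'.
have -> : \sum_(k < p) \sum_(l < p) pair_count X1 X2 k l (w' * z' ^+ (k + l))%g
        = \sum_(k < p) \sum_(l < p) pair_count X1 X2 k l (w * z ^+ (k + l))%g.
  apply: eq_bigr => k _; apply: eq_bigr => l _; apply: pair_count_basic => //.
    by rewrite mulEP_mem ?groupX.
  exact: twist_all.
rewrite (sum_pair_count (sring_setS AX1) (sring_setS AX2) Ew Pz).
rewrite (@pair_count_basic X1 X2 0 0 w w') ?sEG //; last exact: basic_set_projE wzwz'.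
move/eqP; rewrite eqn_add2l eqn_pmul2l => [/eqP // |].
by rewrite subn_gt0 ltn_Pmull ?prime_gt1 ?prime_gt0.
Qed.

Lemma basic_set_eqE x y : x \in G -> (cl x == cl y) = (x \in cl y).
Proof.
move=> Gx; apply/eqP/idP => [<- | /basic_set_eq //]; exact: mem_basic_set.
Qed.

Lemma fibre_products_slice (c1 c2 : {set gT}) w z : w \in E -> z \in P ->
  fibre_products E (fun u => cl (u * z)) c1 c2 w
    = if (c1 \in basic_sets A) && (c2 \in basic_sets A) then slice_count c1 c2 w z else 0%N.
Proof.
move=> Ew Pz; have Gz u : u \in E -> u * z \in G by move=> Eu; apply: mulEP_mem.
case: ifP => [/andP[/basic_setsP[x _ ->] /basic_setsP[y _ ->]] | nb].
  apply: eq_card => u; rewrite !inE; case Eu: (u \in E) => //=.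
  by rewrite !basic_set_eqE ?Gz // groupM ?groupV.
apply: eq_card0 => u; rewrite !inE; apply/and3P=> -[Eu /eqP e1 /eqP e2].
by move: nb; rewrite -e1 -e2 !basic_setP // Gz // groupM ?groupV.
Qed.

(** Colour u by the basic set of u z and by that of u z'. Twisting shows that the fibres agree and
    [slice_count_basic] that the structure constants do, so [colouring_iso_Aut] applies. *)
Lemma exists_E_automorphism w w' z z' :
    w \in E -> w' \in E -> z \in P -> z != 1 -> z' \in P -> z' != 1 ->
    w' * z' \in cl (w * z) ->
  exists2 s, s \in Aut E & s w = w' /\
    forall u, u \in E -> s u * z' \in cl (u * z).
Proof.
move=> Ew Ew' Pz ntz Pz' ntz' wzwz'.
have Gz u t : u \in E -> t \in P -> u * t \in G by apply: mulEP_mem.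
have cEE : abelian E := abelianS subEG cGG.
have fibre_basic v v' t t' c1 c2 : v \in E -> v' \in E -> t \in P -> t' \in P ->
    cl (v * t) = cl (v' * t') ->
    fibre_products E (fun u => cl (u * t)) c1 c2 v
      = fibre_products E (fun u => cl (u * t')) c1 c2 v'.
  move=> Ev Ev' Pt Pt' /eqP; rewrite basic_set_eqE ?Gz // => vt.
  rewrite !fibre_products_slice //; case: ifP => // /andP[].
  case/basic_setsP=> x _ -> /basic_setsP[y _ ->].
  exact: (slice_count_basic (sring_set_basic A x) (sring_set_basic A y)).
have twist_eq t t' u v : t \in P -> t != 1 -> t' \in P -> t' != 1 ->
    u \in E -> v \in E -> u * t \in cl (v * t) -> u * t' \in cl (v * t').
  by move=> Pt ntt Pt' ntt' Eu Ev; have [k co_k ->] := generatorP Pt ntt Pt' ntt';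
     apply: twistP.
have zz' : z' \in cl z := basic_set_projP Ew Pz Ew' Pz' wzwz'.
have [|||||| s AutEs [sw sE]] := @colouring_iso_Aut gT E cEE cardE9 expE {set gT}
  (fun u => cl (u * z)) (fun u => cl (u * z')) _ _ _ _ _ w w' Ew Ew' _.
- move=> u Eu /eqP; rewrite mul1g basic_set_eqE ?Gz // => uz.
  have Puz : u * z \in P by apply: sring_set_closed AP Pz uz.
  have [|//] := mulEP_eq (group1 E) Puz Eu Pz; by rewrite mul1g.
- move=> u v Eu Ev /=; rewrite !basic_set_eqE ?Gz //.
  by apply/idP/idP; apply: twist_eq.
(* The two colourings use the same colours: z' lies in cl(u z) E because z does, so some translate
   of z' by E lies in cl(u z). *)
- move=> u Eu; have AM := sring_setM (sring_set_basic A (u * z)) AE.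
  have : z \in cl (u * z) * E.
    have zE : z = (u * z) * u^-1 by rewrite (commuteEP Eu Pz) mulgK.
    by rewrite {1}zE; apply: mem_mulg; rewrite ?groupV ?mem_basic_set ?Gz.
  move/(sring_set_closed AM)/(_ zz')/mulsgP=> [x e uzx Ee ez'].
  exists e^-1; first by rewrite groupV.
  rewrite (commuteEP (groupVr Ee) Pz') ez' mulgK.
  exact: basic_set_eq.
- by move=> v v' c1 c2 Ev Ev'; apply: fibre_basic.
- by move=> v v' c1 c2 Ev Ev'; apply: fibre_basic.
- by apply/esym/basic_set_eq.
exists s => //; split=> // u Eu.
rewrite -basic_set_eqE; first by rewrite (sE u Eu) eqxx.
by rewrite Gz ?Aut_closed.
Qed.

Lemma extend_automorphism s k : s \in Aut E -> coprime p k ->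
  exists2 a, a \in Aut G & {in E & P, forall u z, a (u * z) = s u * z ^+ k}.
Proof.
move=> AutEs co_k.
(* Here e and q are the projections onto E and P, given by formulas in x. *)
pose e (x : gT) := x ^+ twist_exp 0; pose q x := (e x)^-1 * x.
have eE u t : u \in E -> t \in P -> e (u * t) = u.
  by move=> Eu Pt; rewrite /e expg_twist // mulg1.
have qE u t : u \in E -> t \in P -> q (u * t) = t.
  by move=> Eu Pt; rewrite /q eE // mulKg.
pose f x := s (e x) * q x ^+ k.
have fE u t : u \in E -> t \in P -> f (u * t) = s u * t ^+ k.
  by move=> Eu Pt; rewrite /f eE ?qE.
have cP x y : x \in P -> y \in P -> commute x y.
  by move=> Px Py; apply: (centsP cGG); apply: sPG.
have fM : {in G &, {morph f : x y / x * y}}.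
  move=> _ _ /mulEPP[u [t [Eu Pt ->]]] /mulEPP[v [r [Ev Pr ->]]].
  rewrite -(mulgA u) (mulgA t) -(commuteEP Ev Pt) -(mulgA v) (mulgA u).
  rewrite !fE ?groupM // expgMn; last exact: cP.
  rewrite -!(autmE AutEs) morphM // !autmE -!mulgA; congr (_ * _).
  by rewrite !mulgA (commuteEP _ (groupX k Pt)) // Aut_closed.
have f_inj : 'injm (Morphism fM).
  apply/subsetP=> _ /morphpreP[/mulEPP[u [t [Eu Pt ->]]] /set1P /=].
  rewrite fE // => st1; apply/set1P.
  have Esu : s u \in E by rewrite Aut_closed.
  have [|su1 tk1] := mulEP_eq Esu (groupX k Pt) (group1 E) (group1 P).
    by rewrite st1 mulg1.
  have -> : u = 1 by apply: (@perm_inj _ s); rewrite su1 -(autmE AutEs) morph1.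
  have co : coprime #|P| k by rewrite cardP.
  by rewrite mul1g -(expgK co Pt) /= tk1 expg1n.
have f_im : Morphism fM @* G = G.
  apply/eqP; rewrite eqEcard card_injm // leqnn andbT.
  apply/subsetP=> _ /morphimP[_ _ /mulEPP[u [t [Eu Pt ->]]] ->] /=.
  by rewrite fE // mulEP_mem ?groupX ?Aut_closed.
exists (aut f_inj f_im); first exact: Aut_aut.
by move=> u z Eu Pz; rewrite autE ?mulEP_mem //= fE.
Qed.

(** Act by s on E and by the power map taking z to z' on P. Every nontrivial t in P is a power of z,
    so preservation of the basic set of u t is a twist of the same fact for u z. *)
Lemma exists_G_automorphism w w' z z' :
    w \in E -> w' \in E -> z \in P -> z != 1 -> z' \in P -> z' != 1 ->
    w' * z' \in cl (w * z) ->
  exists2 a, a \in Aut G & [/\ a w = w', a (w * z) = w' * z' &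
    forall x, x \in G -> a x \in cl x].
Proof.
move=> Ew Ew' Pz ntz Pz' ntz' wzwz'.
have [s AutEs [sw sE]] := exists_E_automorphism Ew Ew' Pz ntz Pz' ntz' wzwz'.
have [k co_k z'k] := generatorP Pz ntz Pz' ntz'.
have [a AutGa aE] := extend_automorphism AutEs co_k.
have sEE u : u \in E -> s u \in E by move=> Eu; rewrite Aut_closed.
exists a => //; split; first by rewrite -[w]mulg1 aE // sw expg1n mulg1.
  by rewrite aE // sw -z'k.
move=> _ /mulEPP[u [t [Eu Pt ->]]]; rewrite aE //.
have [-> | ntt] := eqVneq t 1.
  rewrite expg1n !mulg1; apply: basic_set_projE (sE u Eu) => //.
  exact: sEE.
have [j co_j ->] := generatorP Pz ntz Pt ntt.
rewrite -expgM mulnC expgM -z'k; apply: twistP => //; first exact: sEE.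
exact: sE.
Qed.

Lemma aut_fixing_group_set :
  group_set [set a in Aut G | [forall x in G, a x \in cl x]].
Proof.
apply/group_setP; split=> [|a b].
  apply/setIdP; split; first exact: group1.
  by apply/forall_inP=> x Gx; rewrite perm1 mem_basic_set.
case/setIdP=> Aa /forall_inP clAa /setIdP[Ab /forall_inP clAb].
apply/setIdP; split; first exact: groupM.
apply/forall_inP=> x Gx; rewrite permM.
by rewrite -(basic_set_eq (clAa x Gx)) clAb // Aut_closed.
Qed.

(** The group consists of all automorphisms preserving every basic set; what needs proof is its
    transitivity on each of them. *)
Lemma both_cyclotomic : cyclotomic A.
Proof.
exists (Group aut_fixing_group_set).
  by apply/subsetP=> a /setIdP[].
have orbE x : x \in G -> orbit 'P (Group aut_fixing_group_set) x = cl x.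
  move=> Gx; apply/setP=> y; apply/orbitP/idP => [[a] | xy].
    by case/setIdP=> _ /forall_inP clAa <-; apply: clAa.
  have Gy := subsetP (basic_set_sub A x) y xy.
  have [w [z [Ew Pz ex]]] := mulEPP Gx; have [w' [z' [Ew' Pz' ey]]] := mulEPP Gy.
  suff [a AutGa [axy clAa]] : exists2 a, a \in Aut G &
      a x = y /\ forall x, x \in G -> a x \in cl x.
    by exists a => //; apply/setIdP; split=> //; apply/forall_inP.
  have nt_eq : (z == 1) = (z' == 1).
    have inE_eq v t : v \in E -> t \in P -> (v * t \in E) = (t == 1).
      move=> Ev Pt; rewrite groupMl //; apply/idP/eqP => [Et | ->]; last exact: group1.
      have [|//] := @mulEP_eq t 1 1 t Et (group1 P) (group1 E) Pt.
      by rewrite mulg1 mul1g.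
    by rewrite -(inE_eq w z) // -(inE_eq w' z') // -ex -ey (mem_sring_set AE Gx xy).
  have [z1 | ntz] := eqVneq z 1; last first.
    have ntz' : z' != 1 by rewrite -nt_eq.
    rewrite ex ey in xy; have [a AutGa [_ axy clAa]] :=
      exists_G_automorphism Ew Ew' Pz ntz Pz' ntz' xy.
    by exists a; rewrite // ex ey.
  have z'1 : z' = 1 by apply/eqP; rewrite -nt_eq z1.
  rewrite z1 mulg1 in ex; rewrite z'1 mulg1 in ey.
  rewrite -ex in Ew; rewrite -ey in Ew'.
  (* For x and y in E a P-component is supplied artificially: y t^-1 lies in the basic set of x r,
     and an automorphism carrying x r to it also carries x to y. *)
  have [r Pr ntr] := exists_generatorP.
  have AM := sring_setM (sring_set_basic A (x * r)) AP.
  have Gxr : x * r \in G by apply: mulEP_mem.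
  have : x \in cl (x * r) * P.
    by rewrite -{1}(mulgK r x); apply: mem_mulg; rewrite ?groupV ?mem_basic_set.
  move/(sring_set_closed AM)/(_ xy)/mulsgP=> [y1 t xry1 Pt ey1].
  have xry : y * t^-1 \in cl (x * r) by rewrite ey1 mulgK.
  have ntt : t^-1 != 1.
    apply: contraNneq ntr => t1; rewrite t1 mulg1 in xry.
    have Exr : x * r \in E by rewrite -(mem_sring_set AE Gxr xry).
    have [|_ ->//] := mulEP_eq Ew Pr Exr (group1 P); by rewrite mulg1.
  have [a AutGa [axy _ clAa]] :=
    exists_G_automorphism Ew Ew' Pr ntr (groupVr Pt) ntt xry.
  by exists a.
apply/setP=> X; apply/basic_setsP/imsetP => [[x Gx ->] | [x Gx ->]]; exists x => //.
  by rewrite orbE.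
exact: orbE.
Qed.

End BothSubgroups.

(** * Case distinction on which of E and P is an A-subgroup *)

Lemma sring_E9xCp :
  [\/ trivial_sring A \/ cyclotomic A,
      exists (G1 G2 : {group gT}) (A1 : sring G1) (A2 : sring G2),
        [/\ G2 \isog Zp 3, trivial_sring A1 & is_tensor_product A A1 A2]
    | exists U L : {group gT}, is_proper_wreath_product A U L /\ #|U / L| <= 3].
Proof.
have [AE | nAE] := boolP (sring_set A E).
  have [AP | nAP] := boolP (sring_set A P); last by constructor 3; apply: only_E_wreath.
  by constructor 1; right; apply: both_cyclotomic.
have /subsetPn[h Eh nh] : ~~ (E \subset coreE).
  apply: contraNN nAE => sE; rewrite (_ : E = coreE :> {set gT}) ?sring_set_coreE //.
  by apply/eqP; rewrite eqEsubset sE coreE_sub.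
have nh' : h \notin <<coreE>>%G by rewrite /= gen_coreE.
have [tr|te|wr] := proper_core_cases (gen_coreE : <<coreE>>%G = coreE :> {set gT}) Eh nh'.
- by constructor 1; left.
- by constructor 2.
by constructor 3.
Qed.

End Setup.

Lemma extprod_expg (aT bT : finGroupType) (x : aT) (y : bT) n :
  (x, y) ^+ n = (x ^+ n, y ^+ n).
Proof. by elim: n => // n IHn; rewrite !expgS IHn. Qed.

Lemma Zp_expg n (a : 'Z_n) : 0 < n -> a \in Zp n -> a ^+ n = 1.
Proof. by move=> n_gt0 Za; have := expg_cardG Za; rewrite card_Zp. Qed.

Theorem theorem6p1 (p : nat) (p_prime : prime p) (p_gt3 : 3 < p)
    (gT : finGroupType) (G : {group gT})
    (G_isog : G \isog setX (setX (Zp 3) (Zp 3)) (Zp p))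
    (A : sring G) :
  [\/ trivial_sring A \/ cyclotomic A,
      exists (G1 G2 : {group gT}) (A1 : sring G1) (A2 : sring G2),
        [/\ G2 \isog Zp 3, trivial_sring A1 & is_tensor_product A A1 A2]
    | exists U L : {group gT},
        is_proper_wreath_product A U L /\ #|U / L| <= 3].
Proof.
have abT : abelian (setX (setX (Zp 3) (Zp 3)) (Zp p)).
  apply/centsP=> [[[a b] c]] _ [[d e] g] _.
  by congr ((_, _), _); apply: Zp_mulgC.
have cGG : abelian G by rewrite (isog_abelian G_isog).
move: G_isog; rewrite isog_sym => /isogP[f injf fT].
(* E and P are the images under f of the two direct factors of the model group. *)
have defT := setX_dprod (setX_group (Zp_group 3) (Zp_group 3)) (Zp_group p).
have defG := injm_dprod (subxx _) injf defT; rewrite fT in defG.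
apply: (sring_E9xCp A p_prime p_gt3 cGG defG).
- by rewrite card_injm ?setXS ?sub1G // cardsX cards1 muln1 cardsX !card_Zp.
- by rewrite card_injm ?setXS ?sub1G // cardsX cards1 mul1n card_Zp // prime_gt0.
move=> _ /morphimP[[[a b] c] Tx /setXP[/setXP[Za Zb] /set1P /= c1] ->].
rewrite c1 in Tx *.
rewrite -morphX // !extprod_expg !Zp_expg //.
by rewrite expg1n morph1.
Qed.
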